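(* Let $\mathcal{L}=(\mathfrak{g}\otimes S)^\Gamma$ be a twisted current algebra, and let $k_\lambda\otimes V_f$ and $k_\mu\otimes V_g$ be simple finite-dimensional $\mathcal{L}$-modules, where $(\lambda,f),(\mu,g)\in\mathcal{L}^*\times\mathcal{F}^\Gamma$ are admissible pairs. Assume that $k_{\lambda-\mu}$ is not an evaluation module. Then $\mathrm{Ext}^1_{\mathcal{L}}(k_\lambda\otimes V_f,k_\mu\otimes V_g)=0$.
   Context: $k$ is an algebraically closed field of characteristic zero, $\otimes=\otimes_k$. $\mathfrak{g}$ is a finite-dimensional reductive $k$-Lie algebra, $S$ a finitely generated unital commutative associative $k$-algebra, $\Gamma$ a finite group acting on $S$ by $k$-algebra automorphisms $s\mapsto{}^\gamma s$, and $u:\Gamma\to\mathrm{Aut}_{S\text{-}Lie}(\mathfrak{g}\otimes S)$, $\gamma\mapsto u_\gamma$, a crossed homomorphism, so that ${}^\gamma(x\otimes s)=u_\gamma(x\otimes{}^\gamma s)$ defines an action of $\Gamma$ by $k$-Lie algebra automorphisms on $\mathfrak{g}\otimes S$ (with bracket $[x\otimes r,y\otimes s]=[x,y]\otimes rs$). The twisted current algebra is the $k$-Lie algebra of invariants $\mathcal{L}=(\mathfrak{g}\otimes S)^\Gamma$; $\mathcal{L}'=[\mathcal{L},\mathcal{L}]$. Evaluations. For $M\in\mathrm{Max}\,S$ and $z=\sum x_i\otimes s_i\in\mathfrak{g}\otimes S$, put $\mathrm{ev}_M(z)=z(M)=\sum s_i(M)x_i\in\mathfrak{g}$, where $s(M)\in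 k\cong S/M$ is the class of $s$. For $\gamma\in\Gamma$, $\gamma(M)$ is the automorphism $x\mapsto({}^\gamma(x\otimes1))(M)$ of $\mathfrak{g}$. With $\Gamma^M=\{\gamma\in\Gamma:{}^\gamma M=M\}$, one has $\mathrm{ev}_M(\mathcal{L})=\mathfrak{g}^M:=\{x\in\mathfrak{g}:\gamma(M)x=x\ \forall\gamma\in\Gamma^M\}$, a reductive Lie algebra. An $\mathcal{L}$-module is an evaluation module if its action factors through $\mathrm{ev}_{\mathbf M}=(\mathrm{ev}_{M_1},\dots,\mathrm{ev}_{M_r}):\mathcal{L}\to\bigoplus_i\mathrm{ev}_{M_i}(\mathcal{L})$ for some finite $\mathbf M=\{M_1,\dots,M_r\}\subseteq\mathrm{Max}\,S$. Sections. $\mathrm{Rep}(\mathfrak{g}^M)$ is the set of isomorphism classes of finite-dimensional simple $\mathfrak{g}^M$-modules, and $k_0$ is the trivial $1$-dimensional module. $\mathcal{F}$ is the set of maps $f$ assigning to each $M\in\mathrm{Max}\,S$ an element $f(M)\in\mathrm{Rep}(\mathfrak{g}^M)$, with finite support $\mathrm{supp}\,f=\{M:f(M)\ne[k_0]\}$. $\Gamma$ acts on $\mathcal{F}$ by $({}^\gamma f)(M)=[\rho\circ\gamma(M)^{-1}]$, where $\rho$ is a representation of $\mathfrak{g}^{{}^{\gamma^{-1}}M}$ in the class $f({}^{\gamma^{-1}}M)$; $\mathcal{F}^\Gamma$ is the set of $\Gamma$-invariant elements. For $f\in\mathcal{F}^\Gamma$ write $\mathrm{supp}\,f=\bigsqcup_{i=1}^r\Gamma.M_i$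 and let $V_f=V_{f(M_1)}\otimes\cdots\otimes V_{f(M_r)}$, where $V_{f(M_i)}$ is a representative of $f(M_i)$ on which $\mathcal{L}$ acts through $\mathrm{ev}_{M_i}$; the resulting representation is denoted $\rho_f$. (Up to isomorphism $V_f$ is independent of choices, and $f\mapsto V_f$ is a bijection from $\mathcal{F}^\Gamma$ to isomorphism classes of finite-dimensional simple evaluation $\mathcal{L}$-modules.) For $\lambda\in\mathcal{L}^*$ vanishing on $\mathcal{L}'$, $k_\lambda$ is the $1$-dimensional $\mathcal{L}$-module on which $x$ acts by $\lambda(x)$. A pair $(\lambda,f)\in\mathcal{L}^*\times\mathcal{F}^\Gamma$ is called admissible here if the following three conditions hold: $\lambda$ vanishes on $[\mathcal{L},\mathcal{L}]$; $\mathcal{L}/\ker\rho_f$ is semisimple; and $\ker(\lambda\otimes1+1\otimes\rho_f)=(\ker\lambda)\cap(\ker\rho_f)$, where $\lambda\otimes1+1\otimes\rho_f$ is the representation of $\mathcal{L}$ on $k_\lambda\otimes V_f$. (Isomorphism classes of finite-dimensional simple $\mathcal{L}$-modules are in bijection with admissible pairs via $(\lambda,f)\mapsto k_\lambda\otimes V_f$.) $\mathrm{Ext}^1_{\mathcal{L}}(V,W)$ is the space of equivalence classes of short exact sequences of $\mathcal{L}$-modules $0\to W\to E\to V\to0$. *)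

(* Defs.v *)
From HB Require Import structures.
From mathcomp Require Import all_boot all_order all_fingroup all_algebra.
From mathcomp Require Import generic_quotient.
From mathcomp Require Import boolp classical_sets functions cardinality.

Set Implicit Arguments.
Unset Strict Implicit.
Unset Printing Implicit Defensive.

Import GRing.Theory.

Local Open Scope classical_set_scope.
Local Open Scope ring_scope.

HB.mixin Record Lmodule_isLie (k : fieldType) L of GRing.Lmodule k L := {
  lie : L -> L -> L;
  lie_linearl : forall y, linear (fun x => lie x y);
  lie_linearr : forall x, linear (lie x);
  liexx : forall x, lie x x = 0;
  lie_jacobi : forall x y z,
    lie x (lie y z) + lie y (lie z x) + lie z (lie x y) = 0
}.

#[short(type="lieAlgType")]
HB.structure Definition LieAlgebra (k : fieldType) :=
  {L of GRing.Lmodule k L & Lmodule_isLie k L}.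

#[short(type="fdLieAlgType")]
HB.structure Definition FdLieAlgebra (k : fieldType) :=
  {L of Vector k L & LieAlgebra k L}.

Section LieTheory.
Variables (k : fieldType) (L : lieAlgType k).
Implicit Types (x y z : L) (A B I : set L).

Lemma lieDl x y z : lie (x + y) z = lie x z + lie y z.
Proof. by have := @lie_linearl _ L z 1 x y; rewrite !scale1r. Qed.

Lemma lieDr x y z : lie z (x + y) = lie z x + lie z y.
Proof. by have := @lie_linearr _ L z 1 x y; rewrite !scale1r. Qed.

Lemma lie0x x : lie 0 x = 0.
Proof. by apply: (addIr (lie 0 x)); rewrite -lieDl !add0r. Qed.

Lemma liex0 x : lie x 0 = 0.
Proof. by apply: (addIr (lie x 0)); rewrite -lieDr !add0r. Qed.

Lemma lieC x y : lie x y = - lie y x.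
Proof.
apply/eqP; rewrite -subr_eq0 opprK.
by have := liexx (x + y); rewrite lieDl !lieDr !liexx add0r addr0 => ->.
Qed.

Definition is_subspace (V : lmodType k) (W : set V) : Prop :=
  W 0 /\ forall (a : k) (v w : V), W v -> W w -> W (a *: v + w).

Definition is_ideal I : Prop :=
  is_subspace I /\ forall x y, I y -> I (lie x y).

Definition lie_span A B : set L := fun z =>
  exists (n : nat) (c : 'I_n -> k) (a b : 'I_n -> L),
    (forall i, A (a i) /\ B (b i)) /\ z = \sum_i c i *: lie (a i) (b i).

Fixpoint derived_series I (n : nat) : set L :=
  if n is m.+1 then lie_span (derived_series I m) (derived_series I m) else I.

Definition solvable_ideal I : Prop :=
  is_ideal I /\ exists n, derived_series I n `<=` [set 0].

(* A sum of two solvable ideals is a solvable ideal, so that in finite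
   dimension this union is the largest solvable ideal. *)
Definition radical : set L := [set x | exists2 I, solvable_ideal I & I x].

Definition center : set L := [set x | forall y, lie x y = 0].

Definition reductive : Prop := radical = center.

Definition semisimple : Prop := radical = [set 0].

Definition derived : set L := lie_span setT setT.

Lemma derived_lie x y : derived (lie x y).
Proof.
exists 1%N, (fun=> 1), (fun=> x), (fun=> y); split=> //.
by rewrite big_ord1 scale1r.
Qed.

End LieTheory.

Record liehom (k : fieldType) (A B : lieAlgType k) := LieHom {
  liehom_fun :> {linear A -> B};
  liehomE : forall x y, liehom_fun (lie x y) = lie (liehom_fun x) (liehom_fun y)
}.

Section SubLie.
Variables (k : fieldType) (A : lieAlgType k).

Record lie_subalg := LieSubalg {
  lie_subalg_set :> set A;
  lie_subalg_subspace : is_subspace lie_subalg_set;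
  lie_subalg_lie : forall x y,
    lie_subalg_set x -> lie_subalg_set y -> lie_subalg_set (lie x y)
}.

Variable B : lie_subalg.

Definition lie_subalg_mem : pred A := fun x => x \in (B : set A).

Lemma lie_subalg_memP x : reflect ((B : set A) x) (lie_subalg_mem x).
Proof. by apply: (iffP idP) => [/set_mem|/mem_set]. Qed.

Lemma lie_subalg_closed : submod_closed lie_subalg_mem.
Proof.
have [B0 BD] := lie_subalg_subspace B.
split; first exact/lie_subalg_memP.
move=> a x y /lie_subalg_memP Bx /lie_subalg_memP By.
by apply/lie_subalg_memP/BD.
Qed.

HB.instance Definition _ :=
  GRing.isSubmodClosed.Build k A lie_subalg_mem lie_subalg_closed.

Definition sublie := {x : A | lie_subalg_mem x}.
HB.instance Definition _ := SubChoice.on sublie.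
HB.instance Definition _ := [SubChoice_isSubZmodule of sublie by <:].
HB.instance Definition _ := [SubZmodule_isSubLmodule of sublie by <:].

Lemma sublieP (x : sublie) : (B : set A) (val x).
Proof. exact/lie_subalg_memP/valP. Qed.

Definition mk_sublie (x : A) (Bx : (B : set A) x) : sublie :=
  exist _ x (introT (lie_subalg_memP x) Bx).

Definition sublie_lie (x y : sublie) : sublie :=
  mk_sublie (lie_subalg_lie (sublieP x) (sublieP y)).

Fact sublie_linearl y : linear (fun x => sublie_lie x y).
Proof. by move=> a u v; apply/val_inj; rewrite /= lie_linearl. Qed.

Fact sublie_linearr x : linear (sublie_lie x).
Proof. by move=> a u v; apply/val_inj; rewrite /= lie_linearr. Qed.

Fact sublie_xx x : sublie_lie x x = 0.
Proof. by apply/val_inj; rewrite /= liexx. Qed.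

Fact sublie_jacobi x y z : sublie_lie x (sublie_lie y z)
  + sublie_lie y (sublie_lie z x) + sublie_lie z (sublie_lie x y) = 0.
Proof. by apply/val_inj; rewrite /= lie_jacobi. Qed.

HB.instance Definition _ := Lmodule_isLie.Build k sublie
  sublie_linearl sublie_linearr sublie_xx sublie_jacobi.

End SubLie.

Section QuotLie.
Variables (k : fieldType) (A : lieAlgType k).

Record lie_ideal := LieIdeal {
  lie_ideal_set :> set A;
  lie_idealP : is_ideal lie_ideal_set
}.

Variable I : lie_ideal.

Definition lie_ideal_mem : pred A := fun x => x \in (I : set A).

Lemma lie_ideal_memP x : reflect ((I : set A) x) (lie_ideal_mem x).
Proof. by apply: (iffP idP) => [/set_mem|/mem_set]. Qed.

Lemma lie_ideal_closed : submod_closed lie_ideal_mem.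
Proof.
have [[I0 ID] _] := lie_idealP I.
split; first exact/lie_ideal_memP.
move=> a x y /lie_ideal_memP Ix /lie_ideal_memP Iy.
by apply/lie_ideal_memP/ID.
Qed.

HB.instance Definition _ :=
  GRing.isSubmodClosed.Build k A lie_ideal_mem lie_ideal_closed.

Definition lie_ideal_zmod : zmodClosed A :=
  GRing.ZmodClosed.clone A lie_ideal_mem _.

Definition quotlie := Quotient.quot lie_ideal_zmod.
HB.instance Definition _ := GRing.Zmodule.on quotlie.

Local Open Scope quotient_scope.

Definition quot_pi (x : A) : quotlie := \pi_(Quotient.quot lie_ideal_zmod) x.

Lemma quot_piP x y : (quot_pi x = quot_pi y) <-> (I : set A) (x - y).
Proof.
have -> : ((I : set A) (x - y)) = (x - y \in lie_ideal_zmod) :> Prop.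
  by apply/propext; split=> /lie_ideal_memP.
by rewrite (Quotient.idealrBE lie_ideal_zmod); split=> [/eqP|/eqP].
Qed.

Lemma quot_piK (q : quotlie) : quot_pi (repr q) = q.
Proof. exact: reprK. Qed.

Lemma quot_piB : {morph quot_pi : x y / x - y}.
Proof. exact: (pi_is_zmod_morphism (Quotient.quot lie_ideal_zmod)). Qed.


Definition quotlie_scale (a : k) (q : quotlie) : quotlie :=
  quot_pi (a *: repr q).
Definition quotlie_lie (p q : quotlie) : quotlie :=
  quot_pi (lie (repr p) (repr q)).

Lemma quot_repr x : (I : set A) (repr (quot_pi x) - x).
Proof. by apply/quot_piP; rewrite quot_piK. Qed.

Lemma quot_piZ a x : quot_pi (a *: x) = quotlie_scale a (quot_pi x).
Proof.
apply/esym/quot_piP; rewrite -scalerBr.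
have [[I0 ID] _] := lie_idealP I.
by rewrite -[_ *: _]addr0; apply: ID => //; apply: quot_repr.
Qed.

Lemma quot_pi_lie x y :
  quot_pi (lie x y) = quotlie_lie (quot_pi x) (quot_pi y).
Proof.
have [[I0 ID] IL] := lie_idealP I.
apply/esym/quot_piP.
set x' := repr _; set y' := repr _.
have -> : lie x' y' - lie x y = 1 *: (- 1 *: lie y' (x' - x)) + lie x (y' - y).
  rewrite scale1r scaleN1r -(lieC (x' - x)).
  have lieNr u v : lie u (- v) = - lie u v.
    by apply/eqP; rewrite -subr_eq0 opprK -lieDr addNr liex0.
  have lieNl u v : lie (- u) v = - lie u v by rewrite lieC lieNr -lieC.
  by rewrite lieDl lieDr lieNl lieNr addrA subrK.
apply: (ID); last exact/IL/quot_repr.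
by have := ID (- 1) _ _ (IL y' _ (quot_repr x)) I0; rewrite addr0.
Qed.

Lemma quotlie_ind (P : quotlie -> Prop) :
  (forall x, P (quot_pi x)) -> forall q, P q.
Proof. by move=> h q; rewrite -(quot_piK q). Qed.

Lemma quot_piD : {morph quot_pi : x y / x + y}.
Proof.
move=> x y; apply: (addIr (- quot_pi y)).
by rewrite -quot_piB !addrK.
Qed.

Fact quotlie_scalerA a b q :
  quotlie_scale a (quotlie_scale b q) = quotlie_scale (a * b) q.
Proof. by elim/quotlie_ind: q => x; rewrite -!quot_piZ scalerA. Qed.
Fact quotlie_scale1r : left_id 1 quotlie_scale.
Proof. by elim/quotlie_ind => x; rewrite -!quot_piZ scale1r. Qed.
Fact quotlie_scalerDr : right_distributive quotlie_scale +%R.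
Proof.
move=> a; elim/quotlie_ind => x; elim/quotlie_ind => y.
by rewrite -quot_piD -!quot_piZ -quot_piD scalerDr.
Qed.
Fact quotlie_scalerDl q : {morph quotlie_scale^~ q : a b / a + b}.
Proof.
by elim/quotlie_ind: q => x a b; rewrite -!quot_piZ -quot_piD scalerDl.
Qed.

HB.instance Definition _ := GRing.Zmodule_isLmodule.Build k quotlie
  quotlie_scalerA quotlie_scale1r quotlie_scalerDr quotlie_scalerDl.

Fact quot_pi_linear : linear quot_pi.
Proof. by move=> a x y; rewrite quot_piD quot_piZ. Qed.

Fact quotlie_linearl q : linear (fun p => quotlie_lie p q).
Proof.
elim/quotlie_ind: q => z a; elim/quotlie_ind => x; elim/quotlie_ind => y.
by rewrite -quot_pi_linear -!quot_pi_lie -quot_pi_linear lie_linearl.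
Qed.

Fact quotlie_linearr q : linear (quotlie_lie q).
Proof.
elim/quotlie_ind: q => z a; elim/quotlie_ind => x; elim/quotlie_ind => y.
by rewrite -quot_pi_linear -!quot_pi_lie -quot_pi_linear lie_linearr.
Qed.

Lemma quot_pi0 : quot_pi 0 = 0.
Proof. by rewrite -(subrr 0) quot_piB subrr. Qed.

Fact quotlie_xx q : quotlie_lie q q = 0.
Proof. by elim/quotlie_ind: q => x; rewrite -quot_pi_lie liexx quot_pi0. Qed.

Fact quotlie_jacobi p q r : quotlie_lie p (quotlie_lie q r)
  + quotlie_lie q (quotlie_lie r p) + quotlie_lie r (quotlie_lie p q) = 0.
Proof.
elim/quotlie_ind: p => x; elim/quotlie_ind: q => y; elim/quotlie_ind: r => z.
by rewrite -!quot_pi_lie -!quot_piD lie_jacobi quot_pi0.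
Qed.

HB.instance Definition _ := Lmodule_isLie.Build k quotlie
  quotlie_linearl quotlie_linearr quotlie_xx quotlie_jacobi.

End QuotLie.

Section ProdLie.
Variables (k : fieldType) (A B : lieAlgType k).

Definition prod_lie (x y : A * B) : A * B := (lie x.1 y.1, lie x.2 y.2).

Fact prod_linearl y : linear (fun x => prod_lie x y).
Proof. by move=> a u v; rewrite /prod_lie /= !lie_linearl. Qed.

Fact prod_linearr x : linear (prod_lie x).
Proof. by move=> a u v; rewrite /prod_lie /= !lie_linearr. Qed.

Fact prod_xx x : prod_lie x x = 0.
Proof. by rewrite /prod_lie !liexx. Qed.

Fact prod_jacobi x y z : prod_lie x (prod_lie y z)
  + prod_lie y (prod_lie z x) + prod_lie z (prod_lie x y) = 0.
Proof. by rewrite /prod_lie /=; congr pair; rewrite /= lie_jacobi. Qed.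

HB.instance Definition _ := Lmodule_isLie.Build k (A * B)%type
  prod_linearl prod_linearr prod_xx prod_jacobi.

End ProdLie.

Section ZeroLie.
Variable k : fieldType.

Definition lie_zero := 'rV[k]_0.
HB.instance Definition _ := GRing.Lmodule.on lie_zero.

Definition zero_lie (x y : lie_zero) : lie_zero := 0.

Fact zero_linearl y : linear (fun x => zero_lie x y).
Proof. by move=> a u v; rewrite /zero_lie scaler0 addr0. Qed.

Fact zero_linearr x : linear (zero_lie x).
Proof. by move=> a u v; rewrite /zero_lie scaler0 addr0. Qed.

Fact zero_jacobi x y z : zero_lie x (zero_lie y z)
  + zero_lie y (zero_lie z x) + zero_lie z (zero_lie x y) = 0.
Proof. by rewrite /zero_lie !addr0. Qed.

HB.instance Definition _ := Lmodule_isLie.Build k lie_zero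
  zero_linearl zero_linearr (fun=> erefl) zero_jacobi.

End ZeroLie.

Section Tensor.
Variables (k : fieldType) (V : vectType k).

(* Coordinates in the basis vbasis {:V} of V identify V (x) W with the
   functions 'I_(\dim V) -> W; tlift_tpure and tlift_unique below are the
   universal property. *)
Definition tensor (W : lmodType k) := {ffun 'I_(\dim {:V}) -> W}.
HB.instance Definition _ (W : lmodType k) := GRing.Lmodule.on (tensor W).
HB.instance Definition _ (W : vectType k) := Vector.on (tensor W).

Definition tpure (W : lmodType k) (v : V) (w : W) : tensor W :=
  [ffun i => coord (vbasis {:V}) i v *: w].

Definition bilin (W U : lmodType k) (b : V -> W -> U) : Prop :=
  (forall w, linear (fun v => b v w)) /\ (forall v, linear (b v)).

Definition tlift (W U : lmodType k) (b : V -> W -> U) (t : tensor W) : U :=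
  \sum_(i < \dim {:V}) b (vbasis {:V})`_i (t i).

Variables (W U : lmodType k).

Lemma tpure_bilin : bilin (@tpure W).
Proof.
split=> [w|v] a x y; apply/ffunP => i; rewrite !ffunE.
  by rewrite linearP scalerDl scalerA.
by rewrite scalerDr !scalerA mulrC.
Qed.

Lemma tensor_sum (t : tensor W) :
  t = \sum_(i < \dim {:V}) tpure (vbasis {:V})`_i (t i).
Proof.
apply/ffunP=> j; rewrite sum_ffunE (bigD1 j) //= ffunE.
rewrite coord_free ?(basis_free (vbasisP _)) // eqxx scale1r.
rewrite big1 ?addr0 // => i ij; rewrite ffunE.
by rewrite coord_free ?(basis_free (vbasisP _)) // [_ == _](negbTE ij) scale0r.
Qed.

Lemma tlift_linear (b : V -> W -> U) : bilin b -> linear (tlift b).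
Proof.
move=> [_ bl] a x y; rewrite /tlift scaler_sumr -big_split /=.
by apply: eq_bigr => i _; rewrite !ffunE bl.
Qed.

Lemma tlift_tpure (b : V -> W -> U) v w :
  bilin b -> tlift b (tpure v w) = b v w.
Proof.
move=> [bl br]; rewrite /tlift [in RHS](coord_vbasis (memvf v)).
pose bw : {linear V -> U} := HB.pack (fun x => b x w)
  (GRing.isLinear.Build _ _ _ _ _ (bl w)).
rewrite -[RHS]/(bw _) linear_sum; apply: eq_bigr => i _; rewrite ffunE.
pose bv : {linear W -> U} := HB.pack (b (vbasis {:V})`_i)
  (GRing.isLinear.Build _ _ _ _ _ (br _)).
by rewrite -[LHS]/(bv _) !linearZ.
Qed.

Lemma tensor_ind (P : tensor W -> Prop) :
    P 0 -> (forall t u, P t -> P u -> P (t + u)) ->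
  (forall v w, P (tpure v w)) -> forall t, P t.
Proof.
by move=> P0 PD Pp t; rewrite (tensor_sum t); elim/big_ind: _.
Qed.

Lemma linear_fun0 (X : lmodType k) (h : X -> U) : linear h -> h 0 = 0.
Proof.
move=> hl; pose h' : {linear X -> U} := HB.pack h
  (GRing.isLinear.Build _ _ _ _ _ hl).
by rewrite -[LHS]/(h' 0) linear0.
Qed.

Lemma linear_funD (X : lmodType k) (h : X -> U) x y :
  linear h -> h (x + y) = h x + h y.
Proof. by move=> hl; have := hl 1 x y; rewrite !scale1r. Qed.

Lemma linear_funZ (X : lmodType k) (h : X -> U) a x :
  linear h -> h (a *: x) = a *: h x.
Proof.
by move=> hl; have := hl a x 0; rewrite (linear_fun0 hl) !addr0.
Qed.

Lemma tlift_unique (h h' : tensor W -> U) : linear h -> linear h' ->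
  (forall v w, h (tpure v w) = h' (tpure v w)) -> forall t, h t = h' t.
Proof.
move=> hl hl' e; elim/tensor_ind => [||v w]; last exact: e.
  by rewrite !linear_fun0.
by move=> t u et eu; rewrite !linear_funD // et eu.
Qed.

Lemma tlift_bilin (X : lmodType k) (b : X -> V -> W -> U) :
    (forall x, bilin (b x)) -> (forall v w, linear (fun x => b x v w)) ->
  forall t, linear (fun x => tlift (b x) t).
Proof.
move=> bb bl t a x y; rewrite /tlift scaler_sumr -big_split /=.
by apply: eq_bigr => i _; rewrite bl.
Qed.

End Tensor.

Record rep (k : fieldType) (L : lieAlgType k) (V : lmodType k) := Rep {
  act :> L -> V -> V;
  act_linearl : forall v, linear (fun x => act x v);
  act_linearr : forall x, linear (act x);
  act_lie : forall x y v, act (lie x y) v = act x (act y v) - act y (act x v)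
}.

Record fdrep (k : fieldType) (L : lieAlgType k) := FdRep {
  fdspace :> vectType k;
  fdact :> rep L fdspace
}.

Section RepTheory.
Variables (k : fieldType) (L : lieAlgType k).

Definition rep_ker (V : lmodType k) (rho : rep L V) : set L :=
  [set x | forall v, rho x v = 0].

Fact rep_ker_ideal (V : lmodType k) (rho : rep L V) : is_ideal (rep_ker rho).
Proof.
split; first split.
- by move=> v; rewrite (linear_fun0 (act_linearl rho v)).
- by move=> a x y kx ky v; rewrite (act_linearl rho v) kx ky scaler0 addr0.
move=> x y ky v; rewrite act_lie !ky (linear_fun0 (act_linearr rho x)).
by rewrite subrr.
Qed.

Definition rep_kerI (V : lmodType k) (rho : rep L V) : lie_ideal L :=
  LieIdeal (rep_ker_ideal rho).

Definition rep_simple (V : lmodType k) (rho : rep L V) : Prop :=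
  (exists v : V, v <> 0) /\
  forall W : set V, is_subspace W -> (forall x v, W v -> W (rho x v)) ->
    W = [set 0] \/ W = setT.

Definition intertwines (V W : lmodType k) (rho : rep L V) (sigma : rep L W)
    (h : V -> W) : Prop :=
  forall x v, h (rho x v) = sigma x (h v).

Definition rep_iso (V W : lmodType k) (rho : rep L V) (sigma : rep L W) :
    Prop :=
  exists2 h : {linear V -> W}, bijective h & intertwines rho sigma h.

Section Character.
Variables (lambda : {scalar L}).

Definition is_character (nu : L -> k) : Prop := forall x, derived x -> nu x = 0.

Hypothesis chL : is_character lambda.

Definition char_act (x : L) (c : k^o) : k^o := lambda x * c.

Fact char_linearl c : linear (fun x => char_act x c).
Proof. by move=> a x y; rewrite /char_act linearP mulrDl -mulrA. Qed.

Fact char_linearr x : linear (char_act x).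
Proof.
by move=> a c d; rewrite /char_act mulrDr; congr (_ + _); exact: mulrCA.
Qed.

Fact char_lie x y c :
  char_act (lie x y) c = char_act x (char_act y c) - char_act y (char_act x c).
Proof.
by rewrite /char_act (chL (derived_lie x y)) mul0r mulrCA subrr.
Qed.

Definition char_rep : rep L k^o := Rep char_linearl char_linearr char_lie.

End Character.

Fact is_character0 : is_character (\0 : {scalar L}).
Proof. by []. Qed.

Definition triv_rep : rep L k^o := char_rep is_character0.

Fact is_character_sub (lambda mu : {scalar L}) :
  is_character lambda -> is_character mu ->
  is_character (lambda \- mu : {scalar L}).
Proof. by move=> hl hm x dx; rewrite /= hl // hm // subrr. Qed.

Section TensorRep.
Variables (V : vectType k) (W : lmodType k) (rho : rep L V) (sigma : rep L W).

Definition tensor_act (x : L) : tensor V W -> tensor V W :=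
  tlift (fun v w => tpure (rho x v) w + tpure v (sigma x w)).

Let b (x : L) (v : V) (w : W) := tpure (rho x v) w + tpure v (sigma x w).

Fact tensor_act_bilin x : bilin (b x).
Proof.
have [pl pr] := @tpure_bilin k V W.
split=> [w|v] a u u'; rewrite /b.
  by rewrite act_linearr !pl scalerDr addrACA.
by rewrite act_linearr !pr scalerDr addrACA.
Qed.

Lemma tensor_act_tpure x v w :
  tensor_act x (tpure v w) = tpure (rho x v) w + tpure v (sigma x w).
Proof. exact: tlift_tpure (tensor_act_bilin x). Qed.

Fact tensor_act_linearl t : linear (fun x => tensor_act x t).
Proof.
apply: tlift_bilin tensor_act_bilin _ t => v w a x y.
have [pl pr] := @tpure_bilin k V W.
by rewrite /b !act_linearl pl pr scalerDr addrACA.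
Qed.

Fact tensor_act_linearr x : linear (tensor_act x).
Proof. exact/tlift_linear/tensor_act_bilin. Qed.

Fact tensor_act_lie x y t : tensor_act (lie x y) t =
  tensor_act x (tensor_act y t) - tensor_act y (tensor_act x t).
Proof.
have lT := tensor_act_linearr.
have [pl pr] := @tpure_bilin k V W.
have plB u u' w : tpure (u - u') w = tpure u w - tpure u' w :> tensor V W.
  by rewrite addrC -scaleN1r pl scaleN1r addrC.
have prB u w w' : tpure u (w - w') = tpure u w - tpure u w' :> tensor V W.
  by rewrite addrC -scaleN1r pr scaleN1r addrC.
elim/tensor_ind: t => [|t u et eu|v w].
- by rewrite !(linear_fun0 (lT _)) subrr.
- rewrite (linear_funD _ _ (lT _)) et eu.
  by rewrite !(linear_funD _ _ (lT _)) opprD addrACA.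
rewrite !tensor_act_tpure !(linear_funD _ _ (lT _)) !tensor_act_tpure !act_lie.
rewrite plB prB.
move: (tpure (rho x (rho y v)) w) (tpure (rho y (rho x v)) w) => a c.
move: (tpure v (sigma x (sigma y w))) (tpure v (sigma y (sigma x w))) => d e.
move: (tpure (rho y v) (sigma x w)) (tpure (rho x v) (sigma y w)) => f h.
rewrite !opprD [RHS](AC ((2*2)*(2*2)) ((1*5)*(4*8)*(2*7)*(3*6))) /=.
by rewrite !subrr !addr0.
Qed.

Definition tensor_rep : rep L (tensor V W) :=
  Rep tensor_act_linearl tensor_act_linearr tensor_act_lie.

End TensorRep.

End RepTheory.

Section Ext.
Variables (k : fieldType) (L : lieAlgType k) (V W : lmodType k).
Variables (rho : rep L V) (sigma : rep L W).

(* 0 -> W -> E -> V -> 0 *)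
Record extension := Extension {
  ext_mid : lmodType k;
  ext_rep : rep L ext_mid;
  ext_in : {linear W -> ext_mid};
  ext_out : {linear ext_mid -> V};
  ext_in_inj : injective ext_in;
  ext_in_hom : intertwines sigma ext_rep ext_in;
  ext_out_surj : forall v, exists e, ext_out e = v;
  ext_out_hom : intertwines ext_rep rho ext_out;
  ext_exact : forall e, ext_out e = 0 <-> exists w, e = ext_in w
}.

Definition ext_equiv (E E' : extension) : Prop :=
  exists h : {linear ext_mid E -> ext_mid E'},
    [/\ bijective h, intertwines (ext_rep E) (ext_rep E') h,
        forall w, h (ext_in E w) = ext_in E' w
      & forall e, ext_out E' (h e) = ext_out E e].

Definition dsum_act (x : L) (e : W * V) : W * V := (sigma x e.1, rho x e.2).

Fact dsum_act_linearl e : linear (fun x => dsum_act x e).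
Proof. by move=> a x y; rewrite /dsum_act !act_linearl. Qed.

Fact dsum_act_linearr x : linear (dsum_act x).
Proof. by move=> a e f; rewrite /dsum_act !act_linearr. Qed.

Fact dsum_act_lie x y e :
  dsum_act (lie x y) e = dsum_act x (dsum_act y e) - dsum_act y (dsum_act x e).
Proof. by rewrite /dsum_act !act_lie. Qed.

Definition dsum_rep : rep L (W * V)%type :=
  Rep dsum_act_linearl dsum_act_linearr dsum_act_lie.

Definition split_in (w : W) : W * V := (w, 0).
Definition split_out (e : W * V) : V := e.2.

Fact split_in_linear : linear split_in.
Proof.
by move=> a u v; rewrite /split_in; congr pair; rewrite /= scaler0 addr0.
Qed.
HB.instance Definition _ :=
  GRing.isLinear.Build k W (W * V)%type _ split_in split_in_linear.

Fact split_out_linear : linear split_out.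
Proof. by []. Qed.
HB.instance Definition _ :=
  GRing.isLinear.Build k (W * V)%type V _ split_out split_out_linear.

Fact split_in_inj : injective split_in.
Proof. by move=> u v []. Qed.

Fact split_in_hom : intertwines sigma dsum_rep split_in.
Proof.
by move=> x w; rewrite /= /dsum_act /= (linear_fun0 (act_linearr rho x)).
Qed.

Fact split_out_surj v : exists e, split_out e = v.
Proof. by exists (0, v). Qed.

Fact split_out_hom : intertwines dsum_rep rho split_out.
Proof. by []. Qed.

Fact split_exact e : split_out e = 0 <-> exists w, e = split_in w.
Proof.
split=> [|[w ->//]]; case: e => w v /= ->; by exists w.
Qed.

Definition split_ext : extension := @Extension (W * V)%type dsum_rep
  split_in split_out split_in_inj split_in_hom split_out_surj split_out_hom
  split_exact.

(* The class of split_ext is the zero of the vector space Ext^1_L(V, W). *)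
Definition Ext1_eq0 : Prop := forall E : extension, ext_equiv E split_ext.

End Ext.

Section Current.
Variables (k : fieldType) (g : fdLieAlgType k) (S : comAlgType k).

Definition current := tensor g S.
HB.instance Definition _ := GRing.Lmodule.on current.

Implicit Types (x y : g) (r s : S) (z w : current).

Definition current_lie z w : current :=
  tlift (fun x r => tlift (fun y s => tpure (lie x y) (r * s)) w) z.

Let pl := (@tpure_bilin k g S).1.
Let pr := (@tpure_bilin k g S).2.

Let inner_bilin x r : bilin (fun y s => tpure (lie x y) (r * s) : tensor g S).
Proof.
split=> [s|y] a u v; first by rewrite lie_linearr pl.
by rewrite mulrDr -scalerAr pr.
Qed.

Let outer_bilin w :
  bilin (fun x r => tlift (fun y s => tpure (lie x y) (r * s) : tensor g S) w).
Proof.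
split=> [r|x].
  apply: tlift_bilin => [x|y s]; first exact: inner_bilin.
  by move=> a u v; rewrite lie_linearl pl.
apply: tlift_bilin => [r|y s]; first exact: inner_bilin.
by move=> a u v; rewrite mulrDl -scalerAl pr.
Qed.

Lemma current_lie_tpure x y r s :
  current_lie (tpure x r) (tpure y s) = tpure (lie x y) (r * s).
Proof.
by rewrite /current_lie (tlift_tpure _ _ (outer_bilin _)) tlift_tpure.
Qed.

Fact current_linearl w : linear (fun z => current_lie z w).
Proof. exact: tlift_linear. Qed.

Fact current_linearr z : linear (current_lie z).
Proof.
apply: tlift_bilin => [w|x r]; first exact: outer_bilin.
exact: tlift_linear.
Qed.

Let cDl z z' w : current_lie (z + z') w = current_lie z w + current_lie z' w.
Proof. exact: linear_funD _ _ (current_linearl w). Qed.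
Let cDr z w w' : current_lie z (w + w') = current_lie z w + current_lie z w'.
Proof. exact: linear_funD _ _ (current_linearr z). Qed.
Let c0l w : current_lie 0 w = 0.
Proof. exact: linear_fun0 (current_linearl w). Qed.
Let c0r w : current_lie w 0 = 0.
Proof. exact: linear_fun0 (current_linearr w). Qed.
Let tpure0l s : tpure 0 s = 0 :> current.
Proof. exact: linear_fun0 (pl s). Qed.

Let current_anti z w : current_lie z w + current_lie w z = 0.
Proof.
elim/tensor_ind: z => [|z z' hz hz'|x r]; first by rewrite c0l c0r addr0.
  by rewrite cDl cDr addrACA hz hz' addr0.
elim/tensor_ind: w => [|w w' hw hw'|y s]; first by rewrite c0l c0r addr0.
  by rewrite cDl cDr addrACA hw hw' addr0.
rewrite !current_lie_tpure [s * r]mulrC -(linear_funD _ _ (pl _)).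
by rewrite (lieC x y) addNr tpure0l.
Qed.

Fact current_xx z : current_lie z z = 0.
Proof.
elim/tensor_ind: z => [|z w hz hw|x r]; first by rewrite c0l.
  by rewrite cDl !cDr hz hw add0r addr0 current_anti.
by rewrite current_lie_tpure liexx tpure0l.
Qed.

Fact current_jacobi z w v : current_lie z (current_lie w v)
  + current_lie w (current_lie v z) + current_lie v (current_lie z w) = 0.
Proof.
have addr3 (a b c a' b' c' : current) : a + b + c = 0 -> a' + b' + c' = 0 ->
    (a + a') + (b + b') + (c + c') = 0.
  by move=> e e'; rewrite [LHS](AC (2*2*2) ((1*3*5)*(2*4*6))) /= e e' addr0.
elim/tensor_ind: z => [|z z' hz hz'|x r].
- by rewrite !(c0l, c0r) !addr0.
- by rewrite !(cDl, cDr); apply: addr3.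
elim/tensor_ind: w => [|w w' hw hw'|y s].
- by rewrite !(c0l, c0r) !addr0.
- by rewrite !(cDl, cDr); apply: addr3.
elim/tensor_ind: v => [|v v' hv hv'|z t].
- by rewrite !(c0l, c0r) !addr0.
- by rewrite !(cDl, cDr); apply: addr3.
have -> : current_lie (tpure y s) (current_lie (tpure z t) (tpure x r)) =
    tpure (lie y (lie z x)) (r * (s * t)).
  by rewrite !current_lie_tpure (mulrC t) mulrCA.
have -> : current_lie (tpure z t) (current_lie (tpure x r) (tpure y s)) =
    tpure (lie z (lie x y)) (r * (s * t)).
  by rewrite !current_lie_tpure mulrCA (mulrC t).
rewrite !current_lie_tpure.
by rewrite -!(linear_funD _ _ (pl _)) lie_jacobi tpure0l.
Qed.

HB.instance Definition _ := Lmodule_isLie.Build k current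
  current_linearl current_linearr current_xx current_jacobi.

Lemma lie_tpure x y r s :
  lie (tpure x r : current) (tpure y s : current) = tpure (lie x y) (r * s).
Proof. exact: current_lie_tpure. Qed.

Definition cscale (a : S) (z : current) : current :=
  tlift (fun x s => tpure x (a * s)) z.

Let cscale_bilin a : bilin (fun x s => tpure x (a * s) : tensor g S).
Proof.
split=> [s|x] c u v; first by rewrite pl.
by rewrite mulrDr -scalerAr pr.
Qed.

Lemma cscale_tpure a x s : cscale a (tpure x s) = tpure x (a * s).
Proof. exact: tlift_tpure. Qed.

Lemma cscale_linear a : linear (cscale a).
Proof. exact: tlift_linear. Qed.

Lemma cscaleZ (c : k) z : cscale c%:A z = c *: z.
Proof.
apply: (tlift_unique (h := cscale c%:A) (h' := fun z => c *: z)).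
- exact: cscale_linear.
- by move=> a u v; rewrite scalerDr !scalerA mulrC.
- by move=> x s; rewrite cscale_tpure mulr_algl (linear_funZ _ _ (pr x)).
Qed.

Record slie_aut := SLieAut {
  slie_fun :> current -> current;
  slieD : forall z w, slie_fun (z + w) = slie_fun z + slie_fun w;
  slieZ : forall a z, slie_fun (cscale a z) = cscale a (slie_fun z);
  slie_lie : forall z w, slie_fun (lie z w) = lie (slie_fun z) (slie_fun w);
  slie_bij : bijective slie_fun
}.

Lemma slie_linear (u : slie_aut) : linear u.
Proof. by move=> c z w; rewrite -cscaleZ slieD slieZ cscaleZ. Qed.

Definition finitely_generated : Prop :=
  exists a : seq S, forall A : set S,
    is_subspace A -> A 1 -> (forall s t, A s -> A t -> A (s * t)) ->
    (forall s, s \in a -> A s) -> A = setT.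

Definition ring_ideal (I : set S) : Prop :=
  [/\ I 0, forall s t, I s -> I t -> I (s + t) & forall a s, I s -> I (a * s)].

Definition maximal_ideal (M : set S) : Prop :=
  [/\ ring_ideal M, ~ M 1
    & forall J, ring_ideal J -> ~ J 1 -> M `<=` J -> J = M].

Record maxSpec := MaxSpec {
  max_set :> set S;
  maxP : maximal_ideal max_set
}.

Implicit Types M N : maxSpec.

Lemma maxSpec_inj (M N : maxSpec) : (M : set S) = N -> M = N.
Proof.
case: M N => M hM [N hN] /= e.
by case: _ / e in hN *; rewrite (Prop_irrelevance hM hN).
Qed.

(* s(M): the image of s under the k-algebra morphism S -> S/M = k. When k is
   algebraically closed and S is finitely generated, that morphism exists by
   the Nullstellensatz, and the value 0 is never used. *)
Definition residue (M : maxSpec) : S -> k :=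
  if pselect (exists chi : {lrmorphism S -> k^o},
                forall s, chi s = 0 <-> (M : set S) s)
  is left e then projT1 (cid e) else fun=> 0.

Lemma residue_linear M : linear (residue M : S -> k^o).
Proof.
rewrite /residue; case: pselect => [e|_] a s t /=; last first.
  by rewrite scaler0 addr0.
exact: linearP.
Qed.

Lemma residueM M s t : residue M (s * t) = residue M s * residue M t.
Proof.
rewrite /residue; case: pselect => [e|_] /=; last by rewrite mulr0.
exact: rmorphM.
Qed.

Lemma residueE M (chi : {lrmorphism S -> k^o}) :
  (forall s, chi s = 0 <-> (M : set S) s) -> residue M =1 chi.
Proof.
move=> hchi s; rewrite /residue; case: pselect => [e|[]]; last by exists chi.
case: cid => psi hpsi /=.
have : psi (s - (chi s : k)%:A) = 0.
  apply/hpsi/hchi; rewrite linearB linearZ /= rmorph1.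
  by rewrite [_ *: _]mulr1 subrr.
rewrite linearB linearZ /= rmorph1 [_ *: _]mulr1 => /eqP.
by rewrite subr_eq0 => /eqP.
Qed.

Lemma residue_or M : (forall s, residue M s = 0) \/
  exists2 chi : {lrmorphism S -> k^o},
    residue M =1 chi & forall s, chi s = 0 <-> (M : set S) s.
Proof.
rewrite /residue; case: pselect => [e|_]; last by left.
by right; case: cid => chi hchi /=; exists chi.
Qed.

Definition ev (M : maxSpec) (z : current) : g :=
  tlift (fun x s => residue M s *: x) z.

Let ev_bilin M : bilin (fun (x : g) s => residue M s *: x).
Proof.
split=> [s|x] a u v; first by rewrite scalerDr !scalerA mulrC.
by rewrite residue_linear scalerDl scalerA.
Qed.

Lemma ev_tpure M x s : ev M (tpure x s) = residue M s *: x.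
Proof. exact: tlift_tpure. Qed.

Lemma ev_linear M : linear (ev M).
Proof. exact: tlift_linear. Qed.

Lemma ev_cscale M a z : ev M (cscale a z) = residue M a *: ev M z.
Proof.
elim/tensor_ind: z => [|z w hz hw|x s].
- by rewrite (linear_fun0 (cscale_linear a)) (linear_fun0 (ev_linear M))
    scaler0.
- rewrite (linear_funD _ _ (cscale_linear a)).
  by rewrite !(linear_funD _ _ (ev_linear M)) hz hw scalerDr.
- by rewrite cscale_tpure !ev_tpure residueM scalerA.
Qed.

Lemma lieZ (c d : k) x y : lie (c *: x) (d *: y) = (c * d) *: lie x y.
Proof.
rewrite (linear_funZ _ _ (@lie_linearl _ _ _)).
by rewrite (linear_funZ _ _ (@lie_linearr _ _ _)) scalerA.
Qed.

Lemma ev_lie M z w : ev M (lie z w) = lie (ev M z) (ev M w).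
Proof.
have evD := linear_funD _ _ (ev_linear M).
have ev0 := linear_fun0 (ev_linear M).
elim/tensor_ind: z => [|z z' hz hz'|x r].
- by rewrite lie0x ev0 lie0x.
- by rewrite lieDl !evD hz hz' lieDl.
elim/tensor_ind: w => [|w w' hw hw'|y s].
- by rewrite liex0 ev0 liex0.
- by rewrite lieDr !evD hw hw' lieDr.
by rewrite lie_tpure !ev_tpure residueM lieZ.
Qed.

End Current.

Section Twisted.
Variables (k : fieldType) (g : fdLieAlgType k) (S : comAlgType k).
Variable Gamma : finGroupType.

(* Gamma acts on S on the left by sact, and on Aut_{S-Lie}(g (x) S) by
   conjugation with cact c : x (x) s |-> x (x) c.s; a crossed homomorphism u
   satisfies u_{cd} = u_c o (cact c o u_d o cact c^-1). *)
Definition cact_fun (sact : Gamma -> S -> S) (c : Gamma) (z : current g S) :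
    current g S :=
  tlift (fun x s => tpure x (sact c s)) z.

Record twist := Twist {
  sact : Gamma -> {lrmorphism S -> S};
  sact1 : forall s, sact 1%g s = s;
  sactM : forall c d s, sact (c * d)%g s = sact c (sact d s);
  twist_u : Gamma -> slie_aut g S;
  twist_crossed : forall c d z, twist_u (c * d)%g z =
    twist_u c (cact_fun sact c (twist_u d (cact_fun sact c^-1%g z)))
}.

Variable D : twist.
Implicit Types (x : g) (s : S) (z w : current g S) (c d : Gamma).
Implicit Types M N : maxSpec S.

Local Notation cact := (cact_fun (sact D)).

Let pl := (@tpure_bilin k g S).1.
Let pr := (@tpure_bilin k g S).2.

Let cact_bilin c : bilin (fun (x : g) s => tpure x (sact D c s) : tensor g S).
Proof.
split=> [s|x] a u v; first by rewrite pl.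
by rewrite linearP pr.
Qed.

Lemma cact_tpure c x s : cact c (tpure x s) = tpure x (sact D c s).
Proof. exact: tlift_tpure. Qed.

Lemma cact_linear c : linear (cact c).
Proof. exact: tlift_linear. Qed.

Lemma sactK c : cancel (sact D c) (sact D c^-1%g).
Proof. by move=> s; rewrite -sactM mulVg sact1. Qed.

Lemma sactVK c : cancel (sact D c^-1%g) (sact D c).
Proof. by move=> s; rewrite -sactM mulgV sact1. Qed.

Lemma cact_lie c z w : cact c (lie z w) = lie (cact c z) (cact c w).
Proof.
have cD := linear_funD _ _ (cact_linear c).
have c0 := linear_fun0 (cact_linear c).
elim/tensor_ind: z => [|z z' hz hz'|x r].
- by rewrite lie0x c0 lie0x.
- by rewrite lieDl !cD hz hz' lieDl.
elim/tensor_ind: w => [|w w' hw hw'|y s].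
- by rewrite liex0 c0 liex0.
- by rewrite lieDr !cD hw hw' lieDr.
by rewrite lie_tpure !cact_tpure rmorphM lie_tpure.
Qed.

Lemma cactM c d z : cact (c * d)%g z = cact c (cact d z).
Proof.
apply: (tlift_unique (h := cact (c * d)%g) (h' := fun z => cact c (cact d z))).
- exact: cact_linear.
- by move=> a u v; rewrite !cact_linear.
by move=> x s; rewrite !cact_tpure sactM.
Qed.

(* c(x (x) s) = u_c(x (x) c.s) *)
Definition tact c z : current g S := twist_u D c (cact c z).

Lemma tactM c d z : tact (c * d)%g z = tact c (tact d z).
Proof. by rewrite /tact twist_crossed -cactM mulKg. Qed.

Lemma tact_linear c : linear (tact c).
Proof. by move=> a z w; rewrite /tact cact_linear slie_linear. Qed.

Lemma tact_lie c z w : tact c (lie z w) = lie (tact c z) (tact c w).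
Proof. by rewrite /tact cact_lie slie_lie. Qed.

Lemma tact1 z : tact 1%g z = z.
Proof.
have [f fK _] := slie_bij (twist_u D 1%g).
have cactK1 w : cact 1%g w = w.
  apply: (tlift_unique (h := cact 1%g) (h' := id)) => //.
    exact: cact_linear.
  by move=> x s; rewrite cact_tpure sact1.
rewrite /tact cactK1; apply: (can_inj fK).
by have := twist_crossed D 1%g 1%g z; rewrite mulg1 invg1 !cactK1 => <-.
Qed.

Lemma tact_tpure c x s :
  tact c (tpure x s) = cscale (sact D c s) (tact c (tpure x 1)).
Proof. by rewrite /tact !cact_tpure rmorph1 -slieZ cscale_tpure mulr1. Qed.

Definition invariants : set (current g S) := [set z | forall c, tact c z = z].

Fact invariants_subspace : is_subspace invariants.
Proof.
split; first by move=> c; rewrite (linear_fun0 (tact_linear c)).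
by move=> a z w hz hw c; rewrite tact_linear hz hw.
Qed.

Fact invariants_lie z w : invariants z -> invariants w -> invariants (lie z w).
Proof. by move=> hz hw c; rewrite tact_lie hz hw. Qed.

Definition twisted_subalg : lie_subalg (current g S) :=
  LieSubalg invariants_subspace invariants_lie.

Definition twisted_current : lieAlgType k := sublie twisted_subalg.

Fact mact_max c M : maximal_ideal (sact D c @` M).
Proof.
have memE (J : set S) e s : (sact D e @` J) s <-> J (sact D e^-1%g s).
  split=> [[t Jt <-]|Js]; first by rewrite sactK.
  by exists (sact D e^-1%g s); rewrite // sactVK.
have idealP e J : ring_ideal J -> ring_ideal (sact D e @` J).
  case=> J0 JD JM; split.
  - by apply/memE; rewrite rmorph0.
  - by move=> s t /memE Js /memE Jt; apply/memE; rewrite rmorphD; apply: JD.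
  - by move=> a s /memE Js; apply/memE; rewrite rmorphM; apply: JM.
have [Mi M1 Mmax] := maxP M; split; first exact: idealP.
  by move=> /memE; rewrite rmorph1.
move=> J Ji J1 MJ.
rewrite -[in RHS](Mmax (sact D c^-1%g @` J)).
- rewrite predeqE => s; split=> [Js|].
    exists (sact D c^-1%g s); last exact: sactVK.
    by exists s.
  by case=> _ [t Jt <-] <-; rewrite sactVK.
- exact: idealP.
- by move=> /memE; rewrite rmorph1.
- by move=> s Ms; apply/memE; rewrite invgK; apply: MJ; exists s.
Qed.

Definition mact c M : maxSpec S := MaxSpec (mact_max c M).

Lemma mem_mact c M s : (mact c M : set S) s <-> (M : set S) (sact D c^-1%g s).
Proof.
split=> [[t Mt <-]|Ms]; first by rewrite sactK.
by exists (sact D c^-1%g s); rewrite // sactVK.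
Qed.

Lemma mactM c d M : mact (c * d)%g M = mact c (mact d M).
Proof.
apply: maxSpec_inj; rewrite predeqE => s.
by rewrite !mem_mact invMg sactM.
Qed.

Lemma mact1 M : mact 1%g M = M.
Proof.
by apply: maxSpec_inj; rewrite predeqE => s; rewrite mem_mact invg1 sact1.
Qed.

Lemma residue_mact c M s : residue (mact c M) (sact D c s) = residue M s.
Proof.
have half d N (chi : {lrmorphism S -> k^o}) :
    residue N =1 chi -> (forall t, chi t = 0 <-> (N : set S) t) ->
    residue (mact d N) =1 (chi \o sact D d^-1%g).
  move=> _ hchi.
  apply: (@residueE k S (mact d N)
    (chi \o sact D d^-1%g : {lrmorphism S -> k^o})).
  by move=> t; rewrite mem_mact -hchi.
case: (residue_or M) => [M0|[chi e hchi]]; last first.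
  by rewrite (half _ _ _ e hchi) /= sactK e.
case: (residue_or (mact c M)) => [cM0|[chi e hchi]]; first by rewrite M0 cM0.
have := half c^-1%g _ _ e hchi; rewrite -mactM mulVg mact1 => ->.
by rewrite /= invgK e.
Qed.

Definition gact c M x : g := ev M (tact c (tpure x 1)).

Lemma ev_tact c M z : ev M (tact c z) = gact c M (ev (mact c^-1%g M) z).
Proof.
have gactl : linear (gact c M).
  by move=> a x y; rewrite /gact pl tact_linear ev_linear.
elim/tensor_ind: z => [|z w hz hw|x s].
- by rewrite !(linear_fun0 (tact_linear c), linear_fun0 (ev_linear _),
    linear_fun0 gactl).
- rewrite (linear_funD _ _ (tact_linear c)) !(linear_funD _ _ (ev_linear _)).
  by rewrite hz hw (linear_funD _ _ gactl).
rewrite tact_tpure ev_cscale ev_tpure (linear_funZ _ _ gactl).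
by rewrite -(residue_mact c (mact _ _)) -mactM mulgV mact1.
Qed.

Lemma gactM c d M x : gact (c * d)%g M x = gact c M (gact d (mact c^-1%g M) x).
Proof. by rewrite /gact tactM ev_tact. Qed.

Lemma gact_linear c M : linear (gact c M).
Proof. by move=> a x y; rewrite /gact pl tact_linear ev_linear. Qed.

Lemma gact_lie c M x y : gact c M (lie x y) = lie (gact c M x) (gact c M y).
Proof. by rewrite /gact -ev_lie -tact_lie lie_tpure mulr1. Qed.

Definition fixed_set M : set g :=
  [set x | forall c, mact c M = M -> gact c M x = x].

Fact fixed_subspace M : is_subspace (fixed_set M).
Proof.
split; first by move=> c _; rewrite (linear_fun0 (gact_linear c M)).
by move=> a x y hx hy c cM; rewrite gact_linear hx // hy.
Qed.

Fact fixed_lie M x y : fixed_set M x -> fixed_set M y -> fixed_set M (lie x y).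
Proof. by move=> hx hy c cM; rewrite gact_lie hx // hy. Qed.

Definition fixed_subalg M : lie_subalg g :=
  LieSubalg (@fixed_subspace M) (@fixed_lie M).

Definition fixed_alg M : lieAlgType k := sublie (fixed_subalg M).

(* gamma(M)^-1 : g^M -> g^(gamma^-1 M); by gactM it is the restriction of
   (gamma^-1)(gamma^-1 M). *)
Fact gact_inv_fixed c M (x : fixed_alg M) :
  fixed_set (mact c^-1%g M) (gact c^-1%g (mact c^-1%g M) (val x)).
Proof.
move=> d dN; have dN' : mact d^-1%g (mact c^-1%g M) = mact c^-1%g M.
  by rewrite -{1}dN -mactM mulVg mact1.
have -> : gact d (mact c^-1%g M) (gact c^-1%g (mact c^-1%g M) (val x))
        = gact (d * c^-1)%g (mact c^-1%g M) (val x) by rewrite gactM dN'.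
rewrite -[(d * c^-1)%g](mulKg c) gactM; congr gact.
rewrite invgK -mactM mulgV mact1 (sublieP x) //.
by rewrite !mactM dN -mactM mulgV mact1.
Qed.

Definition gact_inv_fun c M (x : fixed_alg M) : fixed_alg (mact c^-1%g M) :=
  @mk_sublie k g (fixed_subalg _) _ (@gact_inv_fixed c M x).
Arguments gact_inv_fun c M x : clear implicits.

Fact gact_inv_linear c M : linear (gact_inv_fun c M).
Proof. by move=> a x y; apply/val_inj; rewrite /= gact_linear. Qed.

HB.instance Definition _ c M :=
  GRing.isLinear.Build k (fixed_alg M) (fixed_alg (mact c^-1%g M)) _
    (gact_inv_fun c M) (@gact_inv_linear c M).

Fact gact_inv_lie c M (x y : fixed_alg M) :
  gact_inv_fun c M (lie x y) = lie (gact_inv_fun c M x) (gact_inv_fun c M y).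
Proof. by apply/val_inj; rewrite /= gact_lie. Qed.

Definition gact_inv c M : liehom (fixed_alg M) (fixed_alg (mact c^-1%g M)) :=
  LieHom (@gact_inv_lie c M).

Lemma gact_invK c M (x : fixed_alg M) :
  gact c M (val (gact_inv c M x)) = val x.
Proof.
by rewrite /= -gactM mulgV (sublieP x) // mact1.
Qed.

Fact ev_fixed M (z : twisted_current) : fixed_set M (ev M (val z)).
Proof.
move=> c cM; have cM' : mact c^-1%g M = M by rewrite -{1}cM -mactM mulVg mact1.
by have := ev_tact c M (val z); rewrite cM' (sublieP z) => <-.
Qed.

Definition ev_tw_fun M (z : twisted_current) : fixed_alg M :=
  @mk_sublie k g (fixed_subalg M) _ (@ev_fixed M z).

Fact ev_tw_linear M : linear (ev_tw_fun M).
Proof. by move=> a x y; apply/val_inj; rewrite /= ev_linear. Qed.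

HB.instance Definition _ M :=
  GRing.isLinear.Build k twisted_current (fixed_alg M) _
    (ev_tw_fun M) (@ev_tw_linear M).

Fact ev_tw_lie M (z w : twisted_current) :
  ev_tw_fun M (lie z w) = lie (ev_tw_fun M z) (ev_tw_fun M w).
Proof. by apply/val_inj; rewrite /= ev_lie. Qed.

Definition ev_tw M : liehom twisted_current (fixed_alg M) :=
  LieHom (@ev_tw_lie M).

Fixpoint ev_target (Ms : seq (maxSpec S)) : lieAlgType k :=
  if Ms is M :: Ms' then (fixed_alg M * ev_target Ms')%type else lie_zero k.

Fixpoint ev_seq (Ms : seq (maxSpec S)) (z : twisted_current) : ev_target Ms :=
  if Ms is M :: Ms' then (ev_tw M z, ev_seq Ms' z) else 0.

(* g^M = ev_M(L) is used for the i-th summand of the target of ev_Ms. *)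
Definition evaluation (V : lmodType k) (rho : rep twisted_current V) : Prop :=
  exists (Ms : seq (maxSpec S)) (sigma : rep (ev_target Ms) V),
    forall (z : twisted_current) v, rho z v = sigma (ev_seq Ms z) v.

End Twisted.

Section Sections.
Variables (k : fieldType) (g : fdLieAlgType k) (S : comAlgType k).
Variables (Gamma : finGroupType) (D : twist g S Gamma).
Implicit Types M : maxSpec S.

Local Notation L := (twisted_current D).

Section Pullback.
Variables (A B : lieAlgType k) (h : liehom A B).
Variables (V : lmodType k) (rho : rep B V).

Definition pull_act (x : A) : V -> V := rho (h x).

Fact pull_linearl v : linear (fun x => pull_act x v).
Proof. by move=> a x y; rewrite /pull_act linearP act_linearl. Qed.

Fact pull_lie x y v :
  pull_act (lie x y) v = pull_act x (pull_act y v) - pull_act y (pull_act x v).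
Proof. by rewrite /pull_act liehomE act_lie. Qed.

Definition pull_rep : rep A V :=
  Rep pull_linearl (fun x => act_linearr rho (h x)) pull_lie.

End Pullback.

(* Elements of Rep(g^M) are handled through representatives, equality in
   Rep(g^M) being rep_iso. *)
Definition rep_family := forall M, fdrep (fixed_alg D M).

Implicit Types f : rep_family.

Definition rep_supp f : set (maxSpec S) :=
  [set M | ~ rep_iso (fdact (f M)) (triv_rep (fixed_alg D M))].

Definition is_section f : Prop :=
  (forall M, rep_simple (fdact (f M))) /\ finite_set (rep_supp f).

Definition family_act (c : Gamma) f : rep_family := fun M =>
  FdRep (pull_rep (gact_inv D c M) (fdact (f (mact D c^-1%g M)))).

Definition invariant_section f : Prop :=
  is_section f /\
  forall c M, rep_iso (fdact (family_act c f M)) (fdact (f M)).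

Definition orbit_reps f (r : nat) (Ms : r.-tuple (maxSpec S)) : Prop :=
  rep_supp f = [set M | exists i c, M = mact D c (tnth Ms i)] /\
  forall i j c, tnth Ms j = mact D c (tnth Ms i) -> i = j.

(* The trivial module k is appended as the empty tensor product. *)
Fixpoint section_rep f (Ms : seq (maxSpec S)) : fdrep L :=
  if Ms is M :: Ms' then
    FdRep (tensor_rep (pull_rep (ev_tw D M) (fdact (f M)))
                      (fdact (section_rep f Ms')))
  else FdRep (triv_rep L).

Definition twist_rep (lambda : {scalar L}) (ch : is_character lambda) f
    (Ms : seq (maxSpec S)) : rep L (tensor k^o (section_rep f Ms)) :=
  tensor_rep (char_rep ch) (fdact (section_rep f Ms)).

Record admissible (lambda : {scalar L}) f (Ms : seq (maxSpec S)) : Prop :=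
  Admissible {
    adm_char : is_character lambda;
    adm_semisimple : semisimple (quotlie (rep_kerI (fdact (section_rep f Ms))));
    adm_ker : rep_ker (twist_rep adm_char f Ms) =
      [set z | lambda z = 0] `&` rep_ker (fdact (section_rep f Ms))
  }.

End Sections.

(* Main.v *)
From HB Require Import structures.
Require Import Defs.
From mathcomp Require Import all_boot all_order all_fingroup all_algebra.
From mathcomp Require Import boolp classical_sets functions.

(** Write chi = mu - lambda. Let p be the ideal of those z in L whose values
    at all points of the two supports vanish. An element z of p acts by the
    scalar lambda(z) on k_lambda (x) V_f and by mu(z) on k_mu (x) V_g. If
    chi(z) <> 0, an extension E of the first module by the second therefore has
    a canonical linear section s_z, onto the lambda(z)-eigenspace of z, and E
    splits as soon as the cocycle c_z : x |-> x s_z - s_z x vanishes.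

    The key is that L is a module over R = S^Gamma, so that multiplication by r
    in R lies in the centroid of L. Comparing c_z [r z, y] with c_z [z, r y]
    gives chi(z) c_z(r y) = chi(r z) c_z(y), and if c_z <> 0 then
    chi(z) chi(r x) = chi(r z) chi(x) for x in p ([cocycle_centroid] and
    [character_centroid]). So if E does not split, eta(r) = chi(r z) / chi(z)
    is a k-algebra character of R that is the same for every z in p with
    chi(z) <> 0. It is the residue character of some maximal ideal M of S
    ([lying_over]).

    A character of L that vanishes on the common kernel of finitely many
    evaluations is an evaluation module ([evaluation_character]). Since
    k_(lambda - mu) is not one, z can be chosen in p with z(M) = 0 and
    chi(z) <> 0, and scaled so that chi(z) = 1. Its coordinates in S vanish on
    the Gamma-orbit of M, so they are nilpotent modulo ker(eta) S: their orbit
    polynomials reduce to powers of X. On the other hand c_z(y) = c_z [z, y],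
    and c_z kills ker(eta) L. Iterating ad z lands in ker(eta) L, so c_z = 0
    ([nilpotent_colon] carries out this iteration), which contradicts that E
    does not split. *)

Set Implicit Arguments.
Unset Strict Implicit.
Unset Printing Implicit Defensive.

Import GRing.Theory.
(* [gact] and [mact] must denote the twisted action on g and on Max S, not the
   notions of the same names for actions of finite groups. *)
Import Defs.
Local Open Scope ring_scope.

(** * Cocycles on which an ideal acts by a character *)

Section CentroidCocycles.
Variables (k : fieldType) (two_neq0 : 2%:R != 0 :> k).
Variables (L : lieAlgType k) (X : lmodType k).
Variables (c : L -> X) (op : L -> X -> X) (p : set L) (chi : L -> k).
Hypothesis opZ : forall y a u, op y (a *: u) = a *: op y u.
Hypothesis cocycle : forall x y, c (lie x y) = op x (c y) - op y (c x).
Hypothesis op_scalar : forall x, p x -> forall y, op x (c y) = chi x *: c y.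

Let op0 y : op y 0 = 0.
Proof. by rewrite -(scale0r 0) opZ !scale0r. Qed.

Lemma cocycle_lie z y : p z -> c z = 0 -> c (lie z y) = chi z *: c y.
Proof. by move=> pz cz; rewrite cocycle op_scalar // cz op0 subr0. Qed.

Variable T : L -> L.
Hypothesis centroidl : forall x y, lie (T x) y = T (lie x y).
Hypothesis centroidr : forall x y, lie x (T y) = T (lie x y).
Hypothesis T_stable : forall x, p x -> p (T x).

(** Both [T z, y] and [z, T y] equal T [z, y]; expanding the cocycle on each
    leaves the term in c (T z), which dies because y = z gives
    2 chi(z) c (T z) = 0. *)
Lemma cocycle_centroid z : p z -> chi z != 0 -> c z = 0 ->
  forall y, chi z *: c (T y) = chi (T z) *: c y.
Proof.
move=> pz chiz cz.
have main y : chi z *: c (T y) = chi (T z) *: c y - op y (c (T z)).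
  rewrite -cocycle_lie // centroidr -centroidl cocycle op_scalar //.
  exact: T_stable.
suff cTz : c (T z) = 0 by move=> y; rewrite main cTz op0 subr0.
have := main z; rewrite cz scaler0 sub0r op_scalar // => /eqP.
rewrite -addr_eq0 -scalerDl -mulr2n -mulr_natl scaler_eq0 mulf_eq0.
by rewrite (negbTE two_neq0) (negbTE chiz) => /eqP.
Qed.

(** Applying [cocycle_centroid] to a bracket [x, y] with x in p, the action
    terms cancel and a relation between scalars times c y remains. *)
Lemma character_centroid z y : p z -> chi z != 0 -> c z = 0 -> c y != 0 ->
  forall x, p x -> chi z * chi (T x) = chi (T z) * chi x.
Proof.
move=> pz chiz cz cy0 x px.
have cT := cocycle_centroid pz chiz cz.
have := cT (lie x y).
rewrite -centroidl !cocycle (op_scalar px) (op_scalar (T_stable px)) !scalerBr.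
rewrite -!opZ cT opZ !scalerA => /addIr/eqP.
by rewrite -subr_eq0 -scalerBl scaler_eq0 (negbTE cy0) orbF subr_eq0 => /eqP.
Qed.

End CentroidCocycles.

(** * Extensions split by the eigenspace of one element *)

Lemma actB (k : fieldType) (L : lieAlgType k) (V : lmodType k) (rho : rep L V)
  x u v : rho x (u - v) = rho x u - rho x v.
Proof. by rewrite -scaleN1r addrC act_linearr scaleN1r addrC. Qed.

Section ScalarSplitting.
Variables (k : fieldType) (L : lieAlgType k) (V W : lmodType k).
Variables (rho : rep L V) (sigma : rep L W) (E : extension rho sigma).

Let tau := ext_rep E.
Let out := ext_out E.

Lemma ext_equiv_split (s : {linear V -> ext_mid E}) :
  cancel s out -> intertwines rho tau s -> ext_equiv E (split_ext rho sigma).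
Proof.
move=> sK s_hom.
have ret e : {w | ext_in E w = e - s (out e)}.
  apply: cid; have /ext_exact[w ->] : out (e - s (out e)) = 0; last by exists w.
  by rewrite linearB /= sK subrr.
pose q e := sval (ret e); have qP e : ext_in E (q e) = e - s (out e).
  exact: svalP (ret e).
have q_lin : linear q.
  move=> a u v; apply: (@ext_in_inj _ _ _ _ _ _ E).
  have -> : ext_in E (a *: q u + q v) = a *: ext_in E (q u) + ext_in E (q v).
    exact: linearP.
  rewrite !qP.
  have -> : s (out (a *: u + v)) = a *: s (out u) + s (out v).
    by rewrite !linearP.
  by rewrite scalerBr opprD addrACA.
have h_lin : linear (fun e => (q e, out e)).
  by move=> a u v; congr pair; rewrite ?q_lin ?linearP.
pose h : {linear ext_mid E -> (W * V)%type} := HB.pack (fun e => (q e, out e))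
  (GRing.isLinear.Build _ _ _ _ _ h_lin).
exists h; split.
- exists (fun t => ext_in E t.1 + s t.2) => [e|[w v]] /=.
    by rewrite qP subrK.
  have outin : out (ext_in E w + s v) = v.
    rewrite linearD /= sK; suff -> : out (ext_in E w) = 0 by rewrite add0r.
    by apply/ext_exact; exists w.
  congr pair; last by [].
  by apply: (@ext_in_inj _ _ _ _ _ _ E); rewrite qP outin addrK.
- move=> x e /=; rewrite /dsum_act /=; congr pair; last exact: ext_out_hom.
  apply: (@ext_in_inj _ _ _ _ _ _ E).
  by rewrite qP ext_in_hom qP actB [out _]ext_out_hom s_hom.
- move=> w /=; rewrite /split_in; have o0 : out (ext_in E w) = 0.
    by apply/ext_exact; exists w.
  congr pair; last exact: o0.
  by apply: (@ext_in_inj _ _ _ _ _ _ E); rewrite qP o0 linear0 subr0.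
- by [].
Qed.

(** (z - a)(z - b) = 0 on the extension, so (a - b)^-1 (z - b) projects it onto
    the a-eigenspace of z along the submodule W. The section sends v to the
    projection of any lift of v. *)
Lemma scalar_section (z : L) (a b : k) : a != b ->
    (forall v, rho z v = a *: v) -> (forall w, sigma z w = b *: w) ->
  exists s : {linear V -> ext_mid E},
    cancel s out /\ forall v, tau z (s v) = a *: s v.
Proof.
move=> ab rz sz.
pose l v := sval (cid (ext_out_surj E v)).
have lP v : out (l v) = v by exact: svalP (cid (ext_out_surj E v)).
pose q e := (a - b)^-1 *: (tau z e - b *: e).
have tl := act_linearr tau z.
have ab0 : a - b != 0 by rewrite subr_eq0.
have q_lin : linear q.
  move=> d u v; rewrite /q tl [b *: _]scalerDr opprD addrACA.
  by rewrite scalerDr scalerA [b * d]mulrC -scalerA -scalerBr !scalerA mulrC.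
have q0 e : out e = 0 -> q e = 0.
  move=> /ext_exact[w ->]; rewrite /q -[tau z _]ext_in_hom sz linearZ /=.
  by rewrite subrr scaler0.
have qE e e' : out e = out e' -> q e = q e'.
  move=> oe; apply/eqP; rewrite -subr_eq0 -scaleN1r addrC -q_lin q0 //.
  by rewrite linearP /= oe scaleN1r addNr.
have outq e : out (q e) = out e.
  rewrite linearZ linearB /= [out (tau z e)]ext_out_hom rz linearZ /= -scalerBl.
  by rewrite scalerA mulVf // scale1r.
have zq e : tau z (q e) = a *: q e.
  apply/eqP; rewrite -subr_eq0; apply/eqP.
  have tZ d u : tau z (d *: u) = d *: tau z u by exact: linear_funZ tl.
  have : out (tau z e - a *: e) = 0.
    by rewrite linearB /= linearZ [out _]ext_out_hom rz subrr.
  move/q0/eqP; rewrite /q scaler_eq0 invr_eq0 (negbTE ab0) /= => /eqP e0.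
  rewrite tZ scalerA mulrC -scalerA -scalerBr -[RHS](scaler0 _ (a - b)^-1) -e0.
  congr (_ *: _); rewrite !actB !tZ !scalerBr !scalerA [b * a]mulrC !opprB.
  rewrite !addrA.
  by rewrite [LHS]addrAC [RHS]addrAC; congr (_ + _); rewrite addrAC.
have s_lin : linear (fun v => q (l v)).
  by move=> d u v; rewrite -q_lin; apply: qE; rewrite lP linearP /= !lP.
pose s : {linear V -> ext_mid E} := HB.pack (fun v => q (l v))
  (GRing.isLinear.Build _ _ _ _ _ s_lin).
by exists s; split=> v; [rewrite /= outq lP | exact: zq].
Qed.

Variable s : {linear V -> ext_mid E}.
Hypothesis sK : cancel s out.

(** The 1-cocycle of the extension attached to the linear section s, with its
    values in W viewed inside the middle term. *)
Definition section_defect (x : L) : V -> ext_mid E :=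
  fun v => tau x (s v) - s (rho x v).

(** The action of L on Hom(V, E), extended to functions that need not be
    linear: this makes the target of the cocycle a plain function space. *)
Definition hom_act (x : L) (phi : V -> ext_mid E) : V -> ext_mid E :=
  fun v => tau x (phi v) - phi (rho x v).

Lemma hom_actZ x a phi : hom_act x (a *: phi) = a *: hom_act x phi.
Proof.
apply/funext => v; rewrite /hom_act /= !fctE.
by rewrite (linear_funZ _ _ (act_linearr tau x)) scalerBr.
Qed.

Lemma section_defect_linear : linear section_defect.
Proof.
move=> a x y; apply/funext => v; rewrite /section_defect !fctE.
by rewrite !act_linearl linearP scalerBr opprD addrACA.
Qed.

Lemma section_defect_cocycle x y : section_defect (lie x y) =
  hom_act x (section_defect y) - hom_act y (section_defect x).
Proof.
apply/funext => v.
rewrite /hom_act /section_defect !fctE !actB !act_lie linearB /=.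
move: (tau x (tau y (s v))) (tau y (tau x (s v))) => a b.
move: (tau x (s (rho y v))) (tau y (s (rho x v))) => d e.
move: (s (rho x (rho y v))) (s (rho y (rho x v))) => u w.
rewrite !opprB !addrA.
by rewrite [RHS](AC 8 ((1*8*3*6)*(2*5)*(4*7))) /= !addNr !addr0.
Qed.

Lemma section_defect_scalar x a b :
    (forall v, rho x v = a *: v) -> (forall w, sigma x w = b *: w) ->
  forall y, hom_act x (section_defect y) = (b - a) *: section_defect y.
Proof.
move=> rx sx y; apply/funext => v; rewrite /hom_act fctE scalerBl.
have /ext_exact[w ew] : out (section_defect y v) = 0.
  by rewrite /section_defect linearB /= [out _]ext_out_hom !sK subrr.
rewrite ew -[tau x _]ext_in_hom sx linearZ -ew /=; congr (_ - _).
rewrite /section_defect rx linearZ /= !(linear_funZ _ _ (act_linearr _ y)).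
by rewrite linearZ scalerBr.
Qed.

End ScalarSplitting.

(** * Maximal ideals and residue characters *)

Section MaximalIdeals.
Variables (k : fieldType) (S : comAlgType k).
Implicit Types (I A : set S) (M : maxSpec S) (s t : S).
Local Open Scope classical_set_scope.

Lemma ring_idealN I s : ring_ideal I -> I s -> I (- s).
Proof. by case=> _ _ IM Is; rewrite -mulN1r; apply: IM. Qed.

Lemma ring_idealB I s t : ring_ideal I -> I s -> I t -> I (s - t).
Proof.
by move=> Ii Is It; case: (Ii) => _ ID _; apply: ID => //; apply: ring_idealN.
Qed.

Lemma ring_ideal_sum I (J : finType) (P : pred J) (F : J -> S) :
  ring_ideal I -> (forall j, P j -> I (F j)) -> I (\sum_(j | P j) F j).
Proof. by case=> I0 ID _ IF; elim/big_ind: _ => //; apply: ID. Qed.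

Lemma sub_maximal_ideal I : ring_ideal I -> ~ I 1 ->
  exists M, I `<=` (M : set S).
Proof.
move=> Ii I1.
(* The empty set is admitted because it is the union of the empty chain. *)
pose P (J : set S) := J = set0 \/ [/\ ring_ideal J, ~ J 1 & I `<=` J].
have [F FP Ftot|M [PM Mmax]] := @Zorn_bigcup S P.
  have [[J FJ J0]|F0] := pselect (exists2 J, F J & J <> set0); last first.
    left; rewrite -subset0 => s [J FJ Js].
    suff -> : set0 = J by [].
    by apply: contrapT => J0; case: F0; exists J => // /esym /J0.
  have FP' K : F K -> K = set0 \/ ring_ideal K.
    by move=> /FP[->|[Ki _ _]]; [left|right].
  have [//|[Ji J1 IJ]] := FP J FJ; right; split; first split.
  - by exists J => //; case: Ji.
  - move=> s t [K FK Ks] [K' FK' K't].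
    have [KK'|K'K] := Ftot K K' FK FK'.
      have [K'0|[_ K'D _]] := FP' _ FK'; first by move: K't; rewrite K'0.
      by exists K' => //; apply: K'D => //; apply: KK'.
    have [K0|[_ KD _]] := FP' _ FK; first by move: Ks; rewrite K0.
    by exists K => //; apply: KD => //; apply: K'K.
  - move=> a s [K FK Ks]; exists K => //.
    have [K0|[_ _ KM]] := FP' _ FK; first by move: Ks; rewrite K0.
    exact: KM.
  - case=> K FK K1; have [K0|[_ nK1 _]] := FP _ FK; last by [].
    by move: K1; rewrite K0.
  - by move=> s /IJ Js; exists J.
have [Mi M1 IM] : [/\ ring_ideal M, ~ M 1 & I `<=` M].
  case: PM => [M0|//]; exfalso; apply: (Mmax I); last by right; split.
  by rewrite M0; split=> // /(_ 0); apply; case: Ii.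
suff MM : maximal_ideal M by exists (MaxSpec MM).
split=> // J Ji J1 MJ; rewrite eqEsubset; split=> //.
apply: contrapT => JM; apply: (Mmax J); first by split.
by right; split=> // s /IM /MJ.
Qed.

Lemma maximal_prime M s t :
  (M : set S) (s * t) -> (M : set S) s \/ (M : set S) t.
Proof.
move=> Mst; have [[M0 MD MM] M1 Mmax] := maxP M.
have [Ms|Ms] := pselect ((M : set S) s); [by left|right].
pose J : set S := [set u | exists2 m, (M : set S) m & exists a, u = m + a * s].
have Ji : ring_ideal J.
  split.
  - by exists 0 => //; exists 0; rewrite mul0r addr0.
  - move=> _ _ [m Mm [a ->]] [n Mn [b ->]]; exists (m + n); first exact: MD.
    by exists (a + b); rewrite mulrDl addrACA.
  - move=> c _ [m Mm [a ->]]; exists (c * m); first exact: MM.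
    by exists (c * a); rewrite mulrDr mulrA.
have MJ : (M : set S) `<=` J.
  by move=> m Mm; exists m => //; exists 0; rewrite mul0r addr0.
have [[m Mm [a e]]|J1] := pselect (J 1).
  by rewrite -[t]mul1r e mulrDl -mulrA mulrC; apply: MD; apply: MM.
case: Ms; rewrite -(Mmax J Ji J1 MJ).
by exists 0 => //; exists 1; rewrite add0r mul1r.
Qed.

Lemma maximal_prod M (ss : seq S) : (M : set S) (\prod_(s <- ss) s) ->
  exists2 s, s \in ss & (M : set S) s.
Proof.
have [_ M1 _] := maxP M.
elim: ss => [|s ss IH]; first by rewrite big_nil.
rewrite big_cons => /maximal_prime[Ms|/IH[t tss Mt]].
  by exists s; rewrite ?mem_head.
by exists t; rewrite // inE tss orbT.
Qed.

(** If S = k + M, the class of s in S / M is a k-algebra character with kernel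
    M, hence it is the residue map. *)
Lemma residue_exists M :
  (forall s, exists a : k, (M : set S) (s - a%:A)) ->
  forall s a, (M : set S) (s - a%:A) -> residue M s = a.
Proof.
move=> ex; have Mi := (let: And3 h _ _ := maxP M in h).
have [[M0 MD MM] M1 _] := maxP M.
have uniq s a b : (M : set S) (s - a%:A) -> (M : set S) (s - b%:A) -> a = b.
  move=> Ma Mb; apply/eqP; rewrite -subr_eq0; apply/eqP; apply: contrapT => ab.
  have := ring_idealB Mi Mb Ma; rewrite opprB addrC subrKA -scalerBl => Mab.
  apply: M1; have := MM ((a - b)^-1%:A) _ Mab.
  by rewrite mulr_algl scalerA mulVf ?scale1r //; apply/eqP.
pose chi (s : S) : k^o := sval (cid (ex s)).
have chiP s : (M : set S) (s - (chi s : k)%:A) by exact: svalP (cid (ex s)).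
have chiE s (a : k) : (M : set S) (s - a%:A) -> chi s = a by exact: uniq.
have chi_lin : linear chi.
  move=> a s t; apply: chiE.
  have := MD _ _ (MM a%:A _ (chiP s)) (chiP t); rewrite mulr_algl.
  by rewrite scalerBr scalerA addrACA -opprD -scalerDl.
have chi_mul : monoid_morphism chi.
  split; first by apply: chiE; rewrite scale1r subrr.
  move=> s t; apply: chiE.
  have := MD _ _ (MM t _ (chiP s)) (MM (chi s : k)%:A _ (chiP t)).
  rewrite !mulrBr !mulr_algl !mulr_algr.
  by rewrite addrA subrK [t * s]mulrC scalerA.
pose chi' : {lrmorphism S -> k^o} := HB.pack chi
  (GRing.isLinear.Build _ _ _ _ _ chi_lin)
  (GRing.isMonoidMorphism.Build _ _ _ chi_mul).
move=> s a Ma; rewrite (@residueE k S M chi') /=; first exact: chiE.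
move=> t; split=> [t0|Mt].
  by have := chiP t; rewrite (t0 : chi t = 0) scale0r subr0.
by apply: chiE; rewrite scale0r subr0.
Qed.

(** Here and below, residue M 1 <> 0 expresses that M does have a residue
    character, that is, that residue M is not the zero function. *)
Lemma residue_ker M s : residue M 1 != 0 -> residue M s = 0 <-> (M : set S) s.
Proof.
by case: (residue_or M) => [->|[chi e h] _]; rewrite ?eqxx // e; apply: h.
Qed.

Lemma residue1 M : residue M 1 != 0 -> residue M 1 = 1.
Proof.
by case: (residue_or M) => [->|[chi e h] _]; rewrite ?eqxx // e rmorph1.
Qed.

Lemma residue_alg0 M s : residue M 1 = 0 -> residue M s = 0.
Proof. by move=> e; rewrite -[s]mulr1 residueM e mulr0. Qed.

End MaximalIdeals.

(** * Invariants of a finite group of algebra automorphisms *)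

Section FiniteGroupInvariants.
Variables (k : fieldType) (S : comAlgType k) (Gamma : finGroupType).
Variable a : Gamma -> {lrmorphism S -> S}.
Hypothesis a1 : forall s, a 1%g s = s.
Hypothesis aM : forall c d s, a (c * d)%g s = a c (a d s).

Definition invariant : set S := [set r | forall c, a c r = r].

Definition orbit_poly (s : S) : {poly S} := \prod_(c : Gamma) ('X - (a c s)%:P).

Lemma monic_orbit_poly s : orbit_poly s \is monic.
Proof. exact: monic_prod_XsubC. Qed.

Lemma size_orbit_poly s : size (orbit_poly s) = #|Gamma|.+1.
Proof. by rewrite size_prod_XsubC /index_enum -enumT -cardT. Qed.

Lemma root_orbit_poly s : (orbit_poly s).[s] = 0.
Proof.
rewrite /orbit_poly horner_prod (bigD1 1%g) //= hornerXsubC a1 subrr.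
by rewrite mul0r.
Qed.

Lemma orbit_poly_invariant s i : invariant (orbit_poly s)`_i.
Proof.
move=> c; rewrite -coef_map.
suff -> : map_poly (a c) (orbit_poly s) = orbit_poly s by [].
rewrite /orbit_poly rmorph_prod /= [RHS](reindex_inj (mulgI c)) /=.
by apply: eq_bigr => d _; rewrite map_polyXsubC aM.
Qed.

(** s is a root of its orbit polynomial, which is monic: s^|Gamma| is a
    combination of the lower coefficients. *)
Lemma orbit_poly_pow (A : set S) s : ring_ideal A ->
  (forall i, (i < #|Gamma|)%N -> A (orbit_poly s)`_i) -> A (s ^+ #|Gamma|).
Proof.
move=> Ai AP; have := root_orbit_poly s.
rewrite horner_coef size_orbit_poly big_ord_recr /=.
have -> : (orbit_poly s)`_#|Gamma| = 1.
  by have /monicP := monic_orbit_poly s; rewrite /lead_coef size_orbit_poly.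
rewrite mul1r addrC => /eqP; rewrite addr_eq0 => /eqP ->.
apply: ring_idealN => //; apply: ring_ideal_sum => // i _.
by rewrite mulrC; have [_ _ AM] := Ai; apply/AM/AP.
Qed.

Definition average (s : S) : S := #|Gamma|%:R^-1 *: \sum_(c : Gamma) a c s.

Lemma average_linear : linear average.
Proof.
move=> e s t; rewrite /average scalerA mulrC -scalerA -scalerDr.
congr (_ *: _); rewrite scaler_sumr -big_split /=.
by apply: eq_bigr => c _; rewrite linearP.
Qed.

Lemma average_invariant s : invariant (average s).
Proof.
move=> c; rewrite linearZ linear_sum [in RHS]/average /=; congr (_ *: _).
rewrite [RHS](reindex_inj (mulgI c)) /=.
by apply: eq_bigr => d _; rewrite aM.
Qed.

Lemma averageM r s : invariant r -> average (r * s) = r * average s.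
Proof.
move=> rinv; rewrite /average -scalerAr mulr_sumr; congr (_ *: _).
by apply: eq_bigr => c _; rewrite rmorphM /= rinv.
Qed.

Hypothesis card_neq0 : #|Gamma|%:R != 0 :> k.

Lemma average_id r : invariant r -> average r = r.
Proof.
move=> rinv; rewrite /average (eq_bigr (fun=> r)) => [|c _]; last exact: rinv.
by rewrite sumr_const -scaler_nat scalerA mulVf // scale1r.
Qed.

End FiniteGroupInvariants.

(** * Characters of the invariant ring come from maximal ideals *)

Section LyingOver.
Variables (k : closedFieldType) (S : comAlgType k) (Gamma : finGroupType).
Variable a : Gamma -> {lrmorphism S -> S}.
Hypothesis a1 : forall s, a 1%g s = s.
Hypothesis aM : forall c d s, a (c * d)%g s = a c (a d s).
Hypothesis card_neq0 : #|Gamma|%:R != 0 :> k.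

Local Open Scope classical_set_scope.

(** Averaging shows that ker eta generates a proper ideal of S; take a maximal
    ideal M containing it. Modulo M the orbit polynomial of s has its
    coefficients in k, so it splits into linear factors over k, and one of the
    factors s - z lies in the prime ideal M. Hence S = k + M. *)
Lemma lying_over (eta : S -> k) :
    linear (eta : S -> k^o) -> eta 1 = 1 ->
    (forall r t, invariant a r -> invariant a t ->
       eta (r * t) = eta r * eta t) ->
  exists M : maxSpec S, forall r, invariant a r -> residue M r = eta r.
Proof.
move=> eta_lin eta1 etaM.
have inv1 : invariant a 1 by move=> c; rewrite rmorph1.
have avg_lin := average_linear a.
have eta0 : eta 0 = 0 by exact: (linear_fun0 eta_lin).
(* This is an ideal containing ker eta, and avoids writing down the ideal
   generated by ker eta. *)
pose I : set S := [set s | forall t, eta (average a (s * t)) = 0].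
have Ii : ring_ideal I.
  split.
  - by move=> t; rewrite mul0r (linear_fun0 avg_lin).
  - move=> s t Is It u; rewrite mulrDl (linear_funD _ _ avg_lin).
    by rewrite (linear_funD _ _ eta_lin) Is It addr0.
  - by move=> s t It u; rewrite mulrAC mulrC It.
have I1 : ~ I 1.
  move/(_ 1); rewrite mulr1 average_id // eta1 => /eqP.
  by rewrite oner_eq0.
have [M IM] := sub_maximal_ideal Ii I1.
have [[M0 MD MM] M1 _] := maxP M.
have Mi : ring_ideal M by [].
have Minv r : invariant a r -> (M : set S) (r - (eta r)%:A).
  move=> rinv; have zinv : invariant a (r - (eta r)%:A).
    by move=> c; rewrite linearB linearZ /= rmorph1 rinv.
  apply: IM => t; rewrite averageM // etaM //; last exact: average_invariant.
  suff -> : eta (r - (eta r)%:A) = 0 by rewrite mul0r.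
  rewrite addrC -scaleN1r scalerA eta_lin mulN1r.
  by rewrite -[LHS]/(- eta r * eta 1 + eta r) eta1 mulr1 addNr.
exists M => r rinv; apply: residue_exists (Minv _ rinv) => s.
pose P := orbit_poly a s; pose n := #|Gamma|.
have Pn : P`_n = 1.
  have /monicP := monic_orbit_poly a s.
  by rewrite /lead_coef size_orbit_poly.
pose q : {poly k} := \poly_(i < n.+1) eta P`_i.
have qlead : lead_coef q = 1 by rewrite lead_coef_poly //= Pn eta1 ?oner_neq0.
have [zs] := closed_field_poly_normal q; rewrite qlead scale1r => qE.
suff : (M : set S) (map_poly (in_alg S) q).[s].
  rewrite qE rmorph_prod horner_prod /= => MP.
  have : (M : set S) (\prod_(t <- [seq s - z%:A | z <- zs]) t).
    rewrite big_map; congr ((M : set S) _) : MP.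
    by apply: eq_bigr => z _; rewrite map_polyXsubC hornerXsubC.
  by case/maximal_prod => _ /mapP[z _ ->]; exists z.
have -> : (map_poly (in_alg S) q).[s] =
    \sum_(i < n.+1) ((eta P`_i)%:A - P`_i) * s ^+ i.
  rewrite (@horner_coef_wide _ n.+1); last first.
    by rewrite (leq_trans (size_poly _ _)) // size_poly.
  transitivity (\sum_(i < n.+1) (eta P`_i)%:A * s ^+ i - P.[s]).
    rewrite root_orbit_poly // subr0; apply: eq_bigr => i _.
    by rewrite coef_map coef_poly ltn_ord.
  rewrite horner_coef size_orbit_poly -sumrB.
  by apply: eq_bigr => i _; rewrite mulrBl.
apply: ring_ideal_sum => // i _; rewrite mulrC; apply: MM.
rewrite -opprB; apply: ring_idealN => //.
exact/Minv/orbit_poly_invariant.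
Qed.

(** If s vanishes on the orbit of M, its orbit polynomial reduces to a power of
    X modulo M, so all its lower coefficients are invariants vanishing at M. *)
Lemma residue_orbit_nilpotent (M : maxSpec S) (A : set S) s :
    ring_ideal A -> (forall r, invariant a r -> residue M r = 0 -> A r) ->
    (forall c, residue M (a c s) = 0) ->
  exists n, A (s ^+ n).
Proof.
move=> Ai Ainv sM; exists #|Gamma|; apply: orbit_poly_pow => // i ltin.
apply: Ainv; first exact: orbit_poly_invariant.
case: (residue_or M) => [->//|[chi e _]].
have chi0 c : chi (a c s) = 0 by rewrite -e.
rewrite e -(coef_map chi) /orbit_poly rmorph_prod /=.
rewrite (eq_bigr (fun=> 'X)) => [|c _]; last first.
  by rewrite map_polyXsubC /= chi0 subr0.
by rewrite prodr_const coefXn -/#|Gamma| ltn_eqF.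
Qed.

End LyingOver.

(** The entries of ss are removed one at a time from the condition ss b <= A,
    descending along the powers of the removed entry. For an ideal A this plays
    the part of the nilpotency of the ideal that ss generates modulo A, without
    a count of monomials. *)
Lemma nilpotent_colon (R : comPzRingType) (A : R -> Prop) (ss : seq R) :
    (forall r b, A b -> A (r * b)) ->
    (forall s, s \in ss -> exists n, A (s ^+ n)) ->
    (forall b, (forall s, s \in ss -> A (s * b)) -> A b) ->
  forall b, A b.
Proof.
move=> AM; elim: ss => [_ colon b|s ss IH nil colon]; first exact: colon.
apply: IH => [t tss|b bss]; first by apply: nil; rewrite inE tss orbT.
have [n An] := nil s (mem_head _ _).
have {An}: A (s ^+ n * b) by rewrite mulrC; apply: AM.
elim: n => [|n IH]; first by rewrite expr0 mul1r.
move=> Asb; apply: IH; apply: colon => t.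
rewrite inE => /predU1P[->|tss]; first by rewrite mulrA -exprS.
by rewrite mulrCA; apply/AM/bss.
Qed.

(** * Multiplication by S on the current algebra *)

Section CurrentScaling.
Variables (k : fieldType) (g : fdLieAlgType k) (S : comAlgType k).
Implicit Types (a b : S) (z w : current g S).

Let pr := (@tpure_bilin k g S).2.
Let cs_lin := @cscale_linear k g S.

Lemma cscale1 z : cscale 1 z = z.
Proof. by rewrite -[1]scale1r cscaleZ scale1r. Qed.

Lemma cscaleM a b z : cscale a (cscale b z) = cscale (a * b) z.
Proof.
apply: (tlift_unique (h := fun z => cscale a (cscale b z))
  (h' := cscale (a * b))); last by move=> x s; rewrite !cscale_tpure mulrA.
  by move=> d u v; rewrite !cs_lin.
exact: cs_lin.
Qed.

Lemma cscale_linearl z : linear (fun a => cscale a z).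
Proof.
move=> d a b; elim/tensor_ind: z => [|z w hz hw|x s].
- by rewrite !(linear_fun0 (cs_lin _)) scaler0 addr0.
- by rewrite !(linear_funD _ _ (cs_lin _)) hz hw scalerDr addrACA.
by rewrite !cscale_tpure mulrDl -scalerAl pr.
Qed.

Lemma lie_cscalel a z w : lie (cscale a z) w = cscale a (lie z w).
Proof.
have csD b := linear_funD _ _ (cs_lin b); have cs0 b := linear_fun0 (cs_lin b).
elim/tensor_ind: z => [|z z' hz hz'|x r].
- by rewrite cs0 lie0x cs0.
- by rewrite csD !lieDl csD hz hz'.
elim/tensor_ind: w => [|w w' hw hw'|y s].
- by rewrite !liex0 cs0.
- by rewrite !lieDr csD hw hw'.
by rewrite cscale_tpure !lie_tpure cscale_tpure mulrA.
Qed.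

Lemma lie_cscaler a z w : lie z (cscale a w) = cscale a (lie z w).
Proof.
rewrite lieC lie_cscalel (lieC z w) -[- lie w z]scaleN1r.
by rewrite (linear_funZ _ _ (cs_lin _)) scaleN1r.
Qed.

Lemma current_coords z :
  z = \sum_(i < \dim {:g}) cscale (z i) (tpure (vbasis {:g})`_i 1).
Proof.
rewrite [LHS]tensor_sum; apply: eq_bigr => i _.
by rewrite cscale_tpure mulr1.
Qed.

Lemma residue_coords (M : maxSpec S) z i : ev M z = 0 -> residue M (z i) = 0.
Proof.
rewrite /ev /tlift => e.
have /freeP/(_ (fun i => residue M (z i))) : free (vbasis {:g}).
  exact: basis_free (vbasisP _).
by apply.
Qed.

End CurrentScaling.

(** * The Reynolds operator onto the twisted current algebra *)

Section Reynolds.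
Variables (k : fieldType) (g : fdLieAlgType k) (S : comAlgType k).
Variables (Gamma : finGroupType) (D : twist g S Gamma).
Implicit Types (z w : current g S) (r : S) (c d : Gamma) (M N : maxSpec S).

Local Notation L := (twisted_current D).
Local Notation invS := (invariant (sact D)).

Lemma tact_cscale c r z :
  tact D c (cscale r z) = cscale (sact D c r) (tact D c z).
Proof.
rewrite /tact -slieZ; congr (twist_u D c _).
apply: (tlift_unique (h := fun z => cact_fun (sact D) c (cscale r z))
  (h' := fun z => cscale (sact D c r) (cact_fun (sact D) c z))).
- by move=> e u v; rewrite cscale_linear cact_linear.
- by move=> e u v; rewrite cact_linear cscale_linear.
by move=> x s; rewrite cscale_tpure !cact_tpure cscale_tpure rmorphM.
Qed.

Fact reynolds_invariant z :
  (twisted_subalg D : set _) (#|Gamma|%:R^-1 *: \sum_(c : Gamma) tact D c z).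
Proof.
move=> d; rewrite (linear_funZ _ _ (tact_linear D d)); congr (_ *: _).
pose t : {linear current g S -> current g S} := HB.pack (tact D d)
  (GRing.isLinear.Build _ _ _ _ _ (tact_linear D d)).
rewrite -[LHS]/(t _) linear_sum [RHS](reindex_inj (mulgI d)) /=.
by apply: eq_bigr => c _; rewrite tactM.
Qed.

Definition reynolds z : L := mk_sublie (reynolds_invariant z).

Lemma reynolds_linear : linear reynolds.
Proof.
move=> e z w; apply/val_inj; rewrite /= scalerA mulrC -scalerA -scalerDr.
congr (_ *: _); rewrite scaler_sumr -big_split /=.
by apply: eq_bigr => c _; rewrite tact_linear.
Qed.

Lemma reynolds_cscale r z : invS r ->
  val (reynolds (cscale r z)) = cscale r (val (reynolds z)).
Proof.
move=> rinv; rewrite /= (linear_funZ _ _ (cscale_linear r)); congr (_ *: _).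
pose t : {linear current g S -> current g S} := HB.pack (cscale r)
  (GRing.isLinear.Build _ _ _ _ _ (cscale_linear r)).
rewrite -[RHS]/(t _) linear_sum; apply: eq_bigr => c _.
by rewrite tact_cscale rinv.
Qed.

Lemma reynolds_lie (x : L) w : reynolds (lie (val x) w) = lie x (reynolds w).
Proof.
apply/val_inj; rewrite /= (linear_funZ _ _ (@lie_linearr _ _ _)).
congr (_ *: _).
pose t : {linear current g S -> current g S} := HB.pack (lie (val x))
  (GRing.isLinear.Build _ _ _ _ _ (lie_linearr (val x))).
rewrite -[RHS]/(t _) linear_sum; apply: eq_bigr => c _.
by rewrite tact_lie (sublieP x).
Qed.

Lemma ev_reynolds M z : ev M (val (reynolds z)) =
  #|Gamma|%:R^-1 *: \sum_c gact D c M (ev (mact D c^-1%g M) z).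
Proof.
rewrite /= (linear_funZ _ _ (ev_linear M)); congr (_ *: _).
pose t : {linear current g S -> g} := HB.pack (ev M)
  (GRing.isLinear.Build _ _ _ _ _ (ev_linear M)).
rewrite -[LHS]/(t _) linear_sum; apply: eq_bigr => c _.
exact: ev_tact.
Qed.

Lemma ev_residue1 M z : residue M 1 *: ev M z = ev M z.
Proof. by rewrite -ev_cscale cscale1. Qed.

Lemma ev_invariant0 c M (z : L) :
  ev M (val z) = 0 -> ev (mact D c M) (val z) = 0.
Proof.
move=> e; rewrite -(sublieP z c) ev_tact -mactM mulVg mact1 e.
exact: linear_fun0 (gact_linear D c _).
Qed.

(** At a point without residue character this says that g^M = 0, which lets all
    points be treated alike below. *)
Lemma fixed_residue1 M (x : fixed_alg D M) : residue M 1 *: val x = val x.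
Proof.
have := sublieP x 1%g (mact1 D M).
by rewrite /gact tact1 ev_tpure.
Qed.

Hypothesis card_neq0 : #|Gamma|%:R != 0 :> k.

Lemma reynolds_id (x : L) : reynolds (val x) = x.
Proof.
apply/val_inj; rewrite /= (eq_bigr (fun=> val x)) => [|c _]; last first.
  exact: (sublieP x).
by rewrite sumr_const -scaler_nat scalerA mulVf // scale1r.
Qed.

End Reynolds.

(** * Characters that vanish on the kernel of finitely many evaluations *)

HB.instance Definition _ (k : fieldType) (S : comAlgType k) :=
  gen_eqMixin (maxSpec S).

Section Separation.
Variables (k : fieldType) (S : comAlgType k).

(** For each N distinct from M some element of N is not in M; e is the product
    of such elements, normalised at M. The value residue M 1 is 1, unless M has
    no residue character: then it is 0, and e = 0. *)
Lemma separating_element (M : maxSpec S) (O : seq (maxSpec S)) : exists e : S,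
  residue M e = residue M 1 /\
  forall N, N \in O -> N != M -> residue N e = 0.
Proof.
have res0 (N : maxSpec S) : residue N 0 = 0.
  exact: (linear_fun0 (residue_linear N)).
have [Mbad|Mgood] := eqVneq (residue M 1) 0.
  by exists 0; rewrite res0 Mbad; split=> // N _ _; rewrite res0.
rewrite residue1 //; elim: O => [|N O [e [eM eO]]].
  by exists 1; rewrite residue1.
have [->|NM] := eqVneq N M.
  by exists e; split=> // N'; rewrite inE => /predU1P[->|/eO//]; rewrite eqxx.
have [Nbad|Ngood] := eqVneq (residue N 1) 0.
  exists e; split=> // N'; rewrite inE => /predU1P[->|/eO//] _.
  exact: residue_alg0.
have [s Ns Ms] : exists2 s, (N : set S) s & ~ (M : set S) s.
  apply: contrapT => NsubM; case/eqP: NM; apply: maxSpec_inj.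
  have [_ _ Nmax] := maxP N; have [Mi M1 _] := maxP M.
  apply/esym/Nmax => // s Ns; apply: contrapT => Ms; apply: NsubM.
  by exists s.
have sM : residue M s != 0 by apply/eqP => /(residue_ker _ Mgood).
exists (e * ((residue M s)^-1 *: s)); split.
  rewrite residueM eM mul1r (linear_funZ _ _ (residue_linear M)).
  exact: mulVf.
move=> N'; rewrite inE => /predU1P[-> _|N'O N'M].
  rewrite residueM (linear_funZ _ _ (residue_linear N)).
  have /(residue_ker _ Ngood) -> := Ns.
  by rewrite scaler0 mulr0.
by rewrite residueM eO // mul0r.
Qed.

End Separation.

Lemma lie_character (k : fieldType) (L : lieAlgType k) (nu : L -> k) :
  linear (nu : L -> k^o) -> (forall x y, nu (lie x y) = 0) -> is_character nu.
Proof.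
move=> nul nu0 _ [n [c [a [b [_ ->]]]]].
pose f : {linear L -> k^o} := HB.pack (nu : L -> k^o)
  (GRing.isLinear.Build _ _ _ _ _ nul).
rewrite -[LHS]/(f _) linear_sum big1 // => i _.
by rewrite linearZ /= nu0 scaler0.
Qed.

Section EvaluationCharacters.
Variables (k : fieldType) (k_char0 : [pchar k] =i pred0).
Variables (g : fdLieAlgType k) (S : comAlgType k).
Variables (Gamma : finGroupType) (D : twist g S Gamma).
Implicit Types (M N : maxSpec S).

Local Notation L := (twisted_current D).

Lemma card_group_neq0 : #|Gamma|%:R != 0 :> k.
Proof.
have /pcharf0P -> := k_char0.
by rewrite -lt0n; apply/card_gt0P; exists 1%g.
Qed.

(** Average x (x) e, with e equal to 1 at M and to 0 at the other points of its
    orbit. Only the stabiliser of M contributes at M, and it fixes x; hence the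
    correction by its order m. *)
Lemma ev_surjective M (x : fixed_alg D M) : exists X : L, ev M (val X) = val x.
Proof.
have [e [eM eO]] := separating_element M [seq mact D c M | c <- enum Gamma].
pose m := #|[set c | mact D c^-1%g M == M]|.
have m_neq0 : m%:R != 0 :> k.
  have /pcharf0P -> := k_char0; rewrite -lt0n; apply/card_gt0P; exists 1%g.
  by rewrite inE invg1 mact1.
exists ((m%:R^-1 * #|Gamma|%:R) *: reynolds D (tpure (val x) e)).
rewrite /= (linear_funZ _ _ (ev_linear M)) ev_reynolds !scalerA.
rewrite mulfK ?card_group_neq0 //.
apply: (canLR (scalerK m_neq0)).
rewrite (bigID (fun c => mact D c^-1%g M == M)) /= [X in _ + X]big1 => [|c cM].
  rewrite addr0 (eq_bigr (fun=> val x)) => [|c /eqP cM]; last first.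
    rewrite ev_tpure cM eM fixed_residue1 (sublieP x) //.
    by rewrite -{1}cM -mactM mulgV mact1.
  by rewrite sumr_const -scaler_nat /m cardsE.
rewrite ev_tpure eO // ?scale0r; last exact/map_f/mem_enum.
exact: linear_fun0 (gact_linear D c M).
Qed.

Lemma ev_target_character (phi : forall M, fixed_alg D M -> k) :
    (forall M, linear (phi M : _ -> k^o)) ->
    (forall M x y, phi M (lie x y) = 0) ->
  forall Ms, exists Phi : ev_target D Ms -> k,
    [/\ linear (Phi : _ -> k^o), forall x y, Phi (lie x y) = 0
      & forall z, Phi (ev_seq Ms z) = \sum_(M <- Ms) phi M (ev_tw D M z)].
Proof.
move=> phil phi0; elim=> [|M Ms [Phi [Phil Phi0 PhiE]]].
  exists (fun=> 0); split=> // [a x y|z]; last by rewrite big_nil.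
  by rewrite scaler0 addr0.
exists (fun t => phi M t.1 + Phi t.2); split.
- by move=> a x y; rewrite /= phil Phil scalerDr addrACA.
- by move=> x y; rewrite /= phi0 Phi0 addr0.
- by move=> z; rewrite big_cons /= PhiE.
Qed.

(** Enlarge Ms to a Gamma-stable list O and pick elements e M that separate its
    points. Each z in L agrees on O with the average of the sum over M in O of
    z(M) (x) e M, so chi(z) is the sum over M of phi M (z(M)), where
    phi M x = chi (average of x (x) e M). Each phi M is a character of g^M: if X
    in L has the value x at M, then [x, y] (x) e M and [X, y (x) e M] agree on
    O, and chi kills the average of the latter, which is a bracket in L. *)
Lemma evaluation_character (chi : {scalar L}) (ch : is_character chi)
    (Ms : seq (maxSpec S)) :
  (forall z : L, (forall M, M \in Ms -> ev M (val z) = 0) -> chi z = 0) ->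
  evaluation (char_rep ch).
Proof.
move=> chi_ker.
pose O := undup [seq mact D c M | M <- Ms, c <- enum Gamma].
have O_stable c M : M \in O -> mact D c M \in O.
  rewrite !mem_undup => /allpairsP[[N d] [/= NMs _ ->]]; rewrite -mactM.
  by apply: allpairs_f; rewrite // mem_enum.
have O_ker w : (forall M, M \in O -> ev M w = 0) -> chi (reynolds D w) = 0.
  move=> w0; apply: chi_ker => M MMs.
  rewrite ev_reynolds big1 ?scaler0 // => c _.
  rewrite w0; first exact: linear_fun0 (gact_linear D c M).
  apply: O_stable; rewrite mem_undup -[M](mact1 D).
  by apply: allpairs_f; rewrite // mem_enum.
pose e M := sval (cid (separating_element M O)).
have eM M : residue M (e M) = residue M 1.
  by have [] := svalP (cid (separating_element M O)).
have eO M N : N \in O -> N != M -> residue N (e M) = 0.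
  by have [_] := svalP (cid (separating_element M O)); apply.
have [pl _] := @tpure_bilin k g S.
pose phi M (x : fixed_alg D M) : k := chi (reynolds D (tpure (val x) (e M))).
have phil M : linear (phi M : _ -> k^o).
  by move=> a x y; rewrite /phi /= pl reynolds_linear linearP.
have phi0 M x y : phi M (lie x y) = 0.
  have [X Xx] := ev_surjective x.
  have chi_lie u v : chi (lie u v) = 0 by apply/ch/derived_lie.
  have := O_ker (tpure (lie (val x) (val y)) (e M)
                 - lie (val X) (tpure (val y) (e M))).
  rewrite addrC -scaleN1r reynolds_linear linearP /= reynolds_lie chi_lie.
  rewrite mulr0 add0r; apply=> N NO.
  rewrite ev_linear ev_lie !ev_tpure; have [->|NM] := eqVneq N M.
    rewrite Xx (linear_funZ _ _ (@lie_linearr _ _ _)).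
    by rewrite scaleN1r addNr.
  by rewrite eO // !scale0r liex0 scaler0 addr0.
have [Phi [Phil Phi0 PhiE]] := ev_target_character phil phi0 O.
pose Phi' : {scalar ev_target D O} := HB.pack (Phi : _ -> k^o)
  (GRing.isLinear.Build _ _ _ _ _ Phil).
have ch' : is_character Phi' by apply: lie_character.
exists O, (char_rep ch') => z v; congr (_ * v); rewrite [RHS]PhiE.
pose w := \sum_(M <- O) tpure (ev M (val z)) (e M) : current g S.
have chiw : chi (reynolds D w) = \sum_(M <- O) phi M (ev_tw D M z).
  pose t : {linear current g S -> k^o} := HB.pack (fun w => chi (reynolds D w))
    (GRing.isLinear.Build _ _ _ _ _ (fun a u v =>
       eq_trans (congr1 chi (reynolds_linear D a u v)) (linearP chi _ _ _))).
  by rewrite -[LHS]/(t w) linear_sum.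
rewrite -chiw; apply/eqP; rewrite -subr_eq0; apply/eqP.
rewrite -linearB -[z in LHS](reynolds_id card_group_neq0) addrC -scaleN1r.
rewrite -reynolds_linear; apply: O_ker => N NO.
rewrite ev_linear scaleN1r; apply/eqP; rewrite addrC subr_eq0; apply/eqP.
pose t : {linear current g S -> g} := HB.pack (ev N)
  (GRing.isLinear.Build _ _ _ _ _ (ev_linear N)).
rewrite -[RHS]/(t w) linear_sum (bigD1_seq N) ?undup_uniq //= big1.
  by rewrite addr0 ev_tpure eM ev_residue1.
by move=> M MN; rewrite ev_tpure eO 1?eq_sym // scale0r.
Qed.

End EvaluationCharacters.

(** * The Ext group *)

Lemma tensor_rep_scalar (k : fieldType) (L : lieAlgType k) (V : vectType k)
    (W : lmodType k) (rho : rep L V) (sigma : rep L W) x a b :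
    (forall v, rho x v = a *: v) -> (forall w, sigma x w = b *: w) ->
  forall t, tensor_rep rho sigma x t = (a + b) *: t.
Proof.
move=> rx sx; have lT := tensor_act_linearr rho sigma x.
have [pl pr] := @tpure_bilin k V W.
elim/tensor_ind => [|t u et eu|v w] /=.
- by rewrite (linear_fun0 lT) scaler0.
- by rewrite (linear_funD _ _ lT) [X in X + _]et [X in _ + X]eu scalerDr.
rewrite tensor_act_tpure rx sx (linear_funZ _ _ (pl w)).
by rewrite (linear_funZ _ _ (pr v)) scalerDl.
Qed.

Section ExtVanishing.
Variables (k : closedFieldType) (k_char0 : [pchar k] =i pred0).
Variables (g : fdLieAlgType k) (S : comAlgType k).
Variables (Gamma : finGroupType) (D : twist g S Gamma).

Local Notation L := (twisted_current D).
Local Notation invS := (invariant (sact D)).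

Let card_neq0 := card_group_neq0 k_char0 Gamma.

Definition ev_kernel (Ms : seq (maxSpec S)) : set L :=
  [set z | forall M, M \in Ms -> ev M (val z) = 0].

Definition rscale (r : S) (x : L) : L := reynolds D (cscale r (val x)).

Lemma val_rscale r x : invS r -> val (rscale r x) = cscale r (val x).
Proof. by move=> rinv; rewrite reynolds_cscale // reynolds_id. Qed.

Lemma rscale_centroidl r : invS r ->
  forall x y, lie (rscale r x) y = rscale r (lie x y).
Proof.
move=> rinv x y; apply/val_inj; rewrite val_rscale //.
by rewrite -[LHS]/(lie (val (rscale r x)) (val y)) val_rscale // lie_cscalel.
Qed.

Lemma rscale_centroidr r : invS r ->
  forall x y, lie x (rscale r y) = rscale r (lie x y).
Proof.
move=> rinv x y; apply/val_inj; rewrite val_rscale //.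
by rewrite -[LHS]/(lie (val x) (val (rscale r y))) val_rscale // lie_cscaler.
Qed.

Lemma rscale_ev_kernel Ms r x : invS r ->
  ev_kernel Ms x -> ev_kernel Ms (rscale r x).
Proof.
by move=> rinv x0 M MMs; rewrite val_rscale // ev_cscale x0 // scaler0.
Qed.

Lemma section_rep_scalar (f : rep_family D) (Ms : seq (maxSpec S)) (z : L) :
  ev_kernel Ms z -> forall v, fdact (section_rep f Ms) z v = 0 *: v.
Proof.
elim: Ms => [_ v|M Ms IH zMs v]; first by rewrite /= /char_act mul0r scale0r.
rewrite -[X in X *: v](addr0 0); move: v; apply: tensor_rep_scalar => [v|].
  rewrite /= /pull_act /=; have -> : ev_tw_fun M z = 0.
    by apply/val_inj/zMs; rewrite mem_head.
  by rewrite (linear_fun0 (act_linearl (fdact (f M)) v)) scale0r.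
by apply: IH => N NMs; apply: zMs; rewrite inE NMs orbT.
Qed.

Lemma twist_rep_scalar (lambda : {scalar L}) (ch : is_character lambda)
    (f : rep_family D) (Ms : seq (maxSpec S)) (z : L) :
  ev_kernel Ms z -> forall v, twist_rep ch f Ms z v = lambda z *: v.
Proof.
move=> zMs v; rewrite -[lambda z]addr0; apply: tensor_rep_scalar => //.
exact: section_rep_scalar.
Qed.

(** Only values at finitely many points decide whether the extension splits:
    those in Ms, whose common kernel acts on both modules by scalars, and those
    on the orbit of the point M that a failure to split would produce. *)
Lemma Ext1_eq0_of_not_evaluation (V W : lmodType k) (rho : rep L V)
    (sigma : rep L W) (lambda mu : {scalar L})
    (ch : is_character (lambda \- mu : {scalar L})) (Ms : seq (maxSpec S)) :
    (forall z, ev_kernel Ms z -> forall v, rho z v = lambda z *: v) ->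
    (forall z, ev_kernel Ms z -> forall w, sigma z w = mu z *: w) ->
    ~ evaluation (char_rep ch) ->
  Ext1_eq0 rho sigma.
Proof.
move=> rho_scalar sigma_scalar not_eval E; apply: contrapT => E_nonsplit.
(* The sign of chi is chosen so that x in p acts on W-valued functions on V
   by the scalar chi x. *)
pose p := ev_kernel Ms; pose chi (x : L) : k := mu x - lambda x.
have chi_lin : linear (chi : L -> k^o).
  by move=> a x y; rewrite /chi !linearP opprD addrACA -mulrBr.
have two_neq0 : 2%:R != 0 :> k by have /pcharf0P -> := k_char0.
have ex_z Ns : exists z, [/\ p z, ev_kernel Ns z & chi z != 0].
  apply: contrapT => no_z; apply: not_eval.
  apply: (@evaluation_character _ k_char0 _ _ _ _ _ _ (Ms ++ Ns)) => z z0.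
  apply/eqP; apply: contrapT => chiz; apply: no_z; exists z; split.
  - by move=> M MMs; apply: z0; rewrite mem_cat MMs.
  - by move=> M MNs; apply: z0; rewrite mem_cat MNs orbT.
  by rewrite /chi -opprB oppr_eq0; apply/negP.
have ex_c z : p z -> chi z != 0 -> exists c : L -> V -> ext_mid E,
    [/\ linear c, exists y, c y != 0,
        forall y, c (lie z y) = chi z *: c y
      & forall r, invS r ->
          (forall y, chi z *: c (rscale r y) = chi (rscale r z) *: c y) /\
          (forall x, p x ->
             chi z * chi (rscale r x) = chi (rscale r z) * chi x)].
  move=> pz chiz.
  have ab : lambda z != mu z by rewrite eq_sym -subr_eq0.
  have [s [sK sz]] := scalar_section E ab (rho_scalar z pz) (sigma_scalar z pz).
  pose c := section_defect s.
  have cocy := section_defect_cocycle s.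
  have scal x px :=
    section_defect_scalar sK (rho_scalar x px) (sigma_scalar x px).
  have cz : c z = 0.
    apply/funext => v; rewrite /c /section_defect sz rho_scalar // linearZ.
    exact: subrr.
  have [y cy] : exists y, c y != 0.
    apply: contrapT => c0; apply: E_nonsplit; apply: (ext_equiv_split sK).
    move=> x v; apply/eqP; rewrite eq_sym -subr_eq0; apply/eqP.
    rewrite -[LHS]/(c x v); suff -> : c x = 0 by [].
    by apply/eqP; apply: contrapT => cx; apply: c0; exists x; apply/negP.
  exists c; split=> //; first exact: section_defect_linear.
  - by exists y.
  - move=> y'.
    exact: (cocycle_lie (@hom_actZ _ _ _ _ _ _ E) cocy scal y' pz cz).
  move=> r rinv; have Tp x := @rscale_ev_kernel Ms r x rinv.
  split=> [y'|x px].
    exact: (cocycle_centroid two_neq0 (@hom_actZ _ _ _ _ _ _ E) cocy scal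
      (rscale_centroidl rinv) (rscale_centroidr rinv) Tp pz chiz cz).
  exact: (character_centroid two_neq0 (@hom_actZ _ _ _ _ _ _ E) cocy scal
    (rscale_centroidl rinv) (rscale_centroidr rinv) Tp pz chiz cz cy px).
have [z0 [pz0 _ chiz0]] := ex_z [::].
have [c0 [_ _ _ c0R]] := ex_c z0 pz0 chiz0.
(* eta is defined through z0, but the relations c0R make it the same for any
   other element of p on which chi does not vanish. *)
pose eta r := chi (rscale r z0) / chi z0.
have eta_lin : linear (eta : S -> k^o).
  move=> a r t; rewrite /eta /rscale cscale_linearl reynolds_linear chi_lin.
  rewrite mulrDl; congr (_ + _); exact/esym/mulrA.
have eta1 : eta 1 = 1.
  by rewrite /eta /rscale cscale1 reynolds_id // divff.
have etaM r t : invS r -> invS t -> eta (r * t) = eta r * eta t.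
  move=> rinv tinv; have [_ /(_ (rscale t z0))] := c0R r rinv.
  move/(_ (rscale_ev_kernel tinv pz0)) => e; rewrite /eta.
  have -> : rscale (r * t) z0 = rscale r (rscale t z0).
    apply/val_inj; rewrite !val_rscale ?cscaleM // => c.
    by rewrite rmorphM /= rinv tinv.
  by rewrite mulf_div -e -mulf_div divff // mul1r.
have [M Meta] := lying_over (sact1 D) (sactM D) card_neq0 eta_lin eta1 etaM.
(* The section is now replaced by the one defined by an element z that also
   vanishes at M. *)
have [z [pz zM chiz]] := ex_z [:: M].
have [c [c_lin [y cy] c_lie cR]] := ex_c z pz chiz.
have cRlin : linear (fun w => c (reynolds D w)).
  by move=> a u v; rewrite reynolds_linear c_lin.
(* The largest ideal A such that c kills the average of A (g (x) S). It will be
   shown to contain 1. *)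
pose A : set S := [set b | forall w, c (reynolds D (cscale b w)) = 0]%classic.
have Ai : ring_ideal A.
  split.
  - move=> w; rewrite (linear_fun0 (cscale_linearl w)).
    exact: linear_fun0 cRlin.
  - move=> a b Aa Ab w; rewrite (linear_funD _ _ (cscale_linearl w)).
    by rewrite (linear_funD _ _ cRlin) Aa Ab addr0.
  - by move=> a b Ab w; rewrite mulrC -cscaleM Ab.
have Ainv r : invS r -> residue M r = 0 -> A r.
  move=> rinv; rewrite Meta // => /eqP.
  rewrite mulf_eq0 invr_eq0 (negbTE chiz0) orbF => /eqP etar w.
  have [cT /(_ z0 pz0)] := cR r rinv; rewrite etar mulr0 => /esym/eqP.
  rewrite mulf_eq0 (negbTE chiz0) orbF => /eqP chir.
  have := cT (reynolds D w); rewrite chir scale0r => /eqP.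
  rewrite scaler_eq0 (negbTE chiz) /= => /eqP <-; congr c.
  by apply/val_inj; rewrite val_rscale // reynolds_cscale.
pose ss := [seq val z i | i <- enum 'I_(\dim {:g})].
have A1 : A 1.
  apply: (nilpotent_colon (ss := ss)) => [r b Ab|t /mapP[i _ ->]|b Assb w].
  - by have [_ _ AM] := Ai; apply: AM.
  - apply: (residue_orbit_nilpotent (sact1 D) (sactM D) Ai Ainv) => d.
    have := residue_mact D d (mact D d^-1%g M) (val z i).
    rewrite -mactM mulgV mact1 => ->; apply: residue_coords.
    by apply: ev_invariant0; apply: zM; rewrite mem_head.
  (* chi(z) c(b w) = c [z, b w] is a sum of terms c (t b [e, w]), t running
     over the coordinates of z and e over the basis of g. *)
  apply/eqP; have := c_lie (reynolds D (cscale b w)).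
  rewrite -reynolds_lie {1}[val z]current_coords.
  pose t : {linear current g S -> V -> ext_mid E} :=
    HB.pack (fun u => c (reynolds D (lie u (cscale b w))))
    (GRing.isLinear.Build _ _ _ _ _ (fun a u v =>
       eq_trans (congr1 (fun u => c (reynolds D u)) (lie_linearl _ a u v))
         (cRlin a _ _))).
  rewrite -[LHS]/(t _) linear_sum big1 /= => [/esym/eqP|i _].
    by rewrite scaler_eq0 (negbTE chiz).
  rewrite lie_cscalel lie_cscaler cscaleM; apply: Assb.
  by rewrite map_f // mem_enum.
by case/eqP: cy; have := A1 (val y); rewrite cscale1 reynolds_id.
Qed.

End ExtVanishing.

Theorem theorem4p2 (k : closedFieldType) (k_char0 : [pchar k] =i pred0)
  (g : fdLieAlgType k) (gred : reductive g)
  (S : comAlgType k) (Sfg : finitely_generated S)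
  (Gamma : finGroupType) (D : twist g S Gamma)
  (lambda mu : {scalar twisted_current D})
  (f : rep_family D) (f_inv : invariant_section f)
  (h : rep_family D) (h_inv : invariant_section h)
  (r : nat) (Ms : r.-tuple (maxSpec S)) (f_Ms : orbit_reps f Ms)
  (s : nat) (Ns : s.-tuple (maxSpec S)) (h_Ns : orbit_reps h Ns)
  (adm_f : admissible lambda f Ms) (adm_h : admissible mu h Ns)
  (simple_f : rep_simple (twist_rep (adm_char adm_f) f Ms))
  (simple_h : rep_simple (twist_rep (adm_char adm_h) h Ns))
  (not_eval :
     ~ evaluation
         (char_rep (is_character_sub (adm_char adm_f) (adm_char adm_h)))) :
  Ext1_eq0 (twist_rep (adm_char adm_f) f Ms) (twist_rep (adm_char adm_h) h Ns).
Proof.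
apply: (@Ext1_eq0_of_not_evaluation _ k_char0 _ _ _ _ _ _ _ _ _ _ _
  (Ms ++ Ns) _ _ not_eval).
  move=> z z0; apply: twist_rep_scalar => M MMs.
  by apply: z0; rewrite mem_cat MMs.
move=> z z0; apply: twist_rep_scalar => M MNs.
by apply: z0; rewrite mem_cat MNs orbT.
Qed.
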